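(* Let $\mathbb{M}$ be a $C^m$-smooth Carnot--Carath\'eodory space of depth $m$ and dimension $N$, $p\in\mathbb{M}$, let $X_1,\dots,X_N$ be a basis in a neighborhood of $p$ subordinate to the filtration of $\mathbb{M}$, and let $\theta_p$ be the corresponding canonical coordinates of the 1st kind in a neighborhood of $p$. Let $\phi_p$ be a $C^m$-smooth coordinate system in a neighborhood of $p$ (a $C^m$-diffeomorphism of a neighborhood of the origin in $\mathbb{R}^N$ onto a neighborhood of $p$). Then the following are equivalent. (a) There is a limit $L(x)=\lim_{\varepsilon\to0}\delta_\varepsilon^{-1}\circ\phi_p^{-1}\circ\theta_p\circ\delta_\varepsilon(x)$, uniform in a neighborhood of the origin, with $L$ a homeomorphism, and there is a limit $\lambda(x)=\lim_{\varepsilon\to0}D\delta_\varepsilon^{-1}\circ D\phi_p^{-1}\circ D\theta_p\circ D\delta_\varepsilon(x)$, uniform in a neighborhood of the origin, with $\det\lambda(0)\ne0$. (b) There are constants $0<C_1\le C_2<\infty$ and $\varepsilon_0>0$ such that $$\phi_p(\mathrm{Box}(C_1\varepsilon))\subset\theta_p(\mathrm{Box}(\varepsilon))\subset\phi_p(\mathrm{Box}(C_2\varepsilon))$$ for all $\varepsilon\in(0,\varepsilon_0)$.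
   Context: A connected $C^\infty$-smooth manifold $\mathbb{M}$ of dimension $N$ is a $C^k$-smooth (equiregular) Carnot--Carath\'eodory space ($k\ge1$) of depth $m$ if there is a fixed filtration $H_1\subsetneq H_2\subsetneq\dots\subsetneq H_m=T\mathbb{M}$ of $T\mathbb{M}$ by $C^k$-smooth distributions (of constant rank) such that $[H_i,H_j]\subset H_{i+j}$ for all $i,j=1,\dots,m$ (with $H_l=T\mathbb{M}$ for $l>m$). A basis $X_1,\dots,X_N$ of $C^k$-smooth vector fields in a neighborhood of $p$ is subordinate to the filtration if $H_l(x)=\mathrm{span}\{X_1(x),\dots,X_{\dim H_l}(x)\}$ for all $l$. The weight of $X_j$ is $\sigma_j=\min\{l:X_j\in H_l\}$. $\exp(Y)(x)$ denotes the time-one value of the integral curve of $Y$ starting at $x$. The canonical coordinates of the 1st kind are $\theta_p(u_1,\dots,u_N)=\exp(u_1X_1+\dots+u_NX_N)(p)$. For $\varepsilon>0$, $\delta_\varepsilon(x_1,\dots,x_N)=(\varepsilon^{\sigma_1}x_1,\dots,\varepsilon^{\sigma_N}x_N)$; $\mathrm{Box}(r)=\{x\in\mathbb{R}^N:\max_k|x_k|^{1/\sigma_k}<r\}$. The expression $D\delta_\varepsilon^{-1}\circ D\phi_p^{-1}\circ D\theta_p\circ D\delta_\varepsilon(x)$ is the differential at $x$ of $\delta_\varepsilon^{-1}\circ\phi_p^{-1}\circ\theta_p\circ\delta_\varepsilon$. The map $L$, a priori defined near the origin, is extended to $\mathbb{R}^N$ by homogeneity ($L\circ\delta_\varepsilon=\delta_\varepsilon\circ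 L$). *)

(* Defs.v *)
(* MathComp-Analysis *)
From HB Require Import structures.
From mathcomp Require Import all_boot all_order all_algebra.
From mathcomp Require Import all_classical all_reals all_analysis.
Set Implicit Arguments.
Unset Strict Implicit.
Unset Printing Implicit Defensive.
Import Order.TTheory GRing.Theory Num.Theory.
Import numFieldNormedType.Exports.
Local Open Scope classical_set_scope.
Local Open Scope ring_scope.

(* [f] is C^k on [A] (meant for open [A]): C^(k+1) means differentiable with
   C^k derivative, the derivative being tested along each fixed vector. *)
Fixpoint Ck (R : realType) (n p k : nat) (A : set 'rV[R]_n)
    (f : 'rV[R]_n -> 'rV[R]_p) : Prop :=
  match k with
  | 0%N => forall x, A x -> {for x, continuous f}
  | k'.+1 => (forall x, A x -> differentiable f x) /\
             forall v, Ck k' A (fun x => 'd f x v)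
  end.

(* [cmap] and [cinv] are total functions, meaningful only on [csrc] and [ctgt]
   respectively. *)
Record chart (R : realType) (N : nat) (T : topologicalType) := Chart {
  csrc : set T;
  ctgt : set 'rV[R]_N;
  cmap : T -> 'rV[R]_N;
  cinv : 'rV[R]_N -> T;
  csrc_open : open csrc;
  ctgt_open : open ctgt;
  cmap_in : forall x, csrc x -> ctgt (cmap x);
  cinv_in : forall y, ctgt y -> csrc (cinv y);
  cmapK : forall x, csrc x -> cinv (cmap x) = x;
  cinvK : forall y, ctgt y -> cmap (cinv y) = y;
  cmap_cont : forall x, csrc x -> {for x, continuous cmap};
  cinv_cont : forall y, ctgt y -> {for y, continuous cinv} }.

Definition Ck_compatible (R : realType) (N : nat) (T : topologicalType)
    (k : nat) (c d : chart R N T) : Prop :=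
  Ck k (cmap c @` (csrc c `&` csrc d)) (cmap d \o cinv c) /\
  Ck k (cmap d @` (csrc c `&` csrc d)) (cmap c \o cinv d).

(* Each point comes with a preferred chart [chart_at x] of the atlas. A tangent
   vector at [x] is represented by its components in that chart, so that T_xM is
   identified with 'rV[R]_N for every [x]. *)
Record smooth_manifold (R : realType) (N : nat) := SmoothManifold {
  mcarrier :> topologicalType;
  atlas : set (chart R N mcarrier);
  chart_at : mcarrier -> chart R N mcarrier;
  chart_at_atlas : forall x, atlas (chart_at x);
  chart_at_src : forall x, csrc (chart_at x) x;
  atlas_compatible : forall c d, atlas c -> atlas d ->
    forall k, Ck_compatible k c d;
  manifold_hausdorff : hausdorff_space mcarrier;
  manifold_second_countable : @second_countable mcarrier;
  manifold_connected : connected [set: mcarrier] }.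

Section VectorFields.
Context (R : realType) (N : nat) (M : smooth_manifold R N).

(* A function [M -> 'rV[R]_N] is read as a vector field through the above
   identification of the tangent spaces. *)
Implicit Types X Y : M -> 'rV[R]_N.

(* Components in the chart [c] of the tangent vector [v] at [x]. *)
Definition tcoord (c : chart R N M) (x : M) (v : 'rV[R]_N) : 'rV[R]_N :=
  'd (cmap c \o cinv (chart_at x)) (cmap (chart_at x) x) v.

Definition vf_in (c : chart R N M) X : 'rV[R]_N -> 'rV[R]_N :=
  fun y => tcoord c (cinv c y) (X (cinv c y)).

Definition Ck_vector_field (k : nat) (U : set M) X : Prop :=
  forall c, atlas c -> Ck k (cmap c @` (U `&` csrc c)) (vf_in c X).

(* [X, Y] = DY.X - DX.Y in the preferred chart at [x]. *)
Definition lie_bracket X Y (x : M) : 'rV[R]_N :=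
  let c := chart_at x in
  let y := cmap c x in
  'd (vf_in c Y) y (vf_in c X y) - 'd (vf_in c X) y (vf_in c Y y).

Definition is_velocity (g : R -> M) (t : R) (v : 'rV[R]_N) : Prop :=
  {for t, continuous g} /\
  is_derive t (1 : R) (cmap (chart_at (g t)) \o g) v.

(* [y] is exp(Y)(x), for a vector field [Y] defined on the open set [U]. *)
Definition is_exp (U : set M) Y (x y : M) : Prop :=
  exists g : R -> M, [/\ g 0 = x, g 1 = y &
    forall t, 0 <= t <= 1 -> U (g t) /\ is_velocity g t (Y (g t))].

End VectorFields.

(* C^k-smooth equiregular Carnot--Caratheodory space of depth [m]. Only the
   indices [1 <= l] of [filt] are meaningful, and [filt l] is TM for [l >= m]. *)
Record cc_space (R : realType) (N k m : nat) := CCSpace {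
  cc_manifold :> smooth_manifold R N;
  filt : nat -> cc_manifold -> {vspace 'rV[R]_N};
  cc_smoothness : (1 <= k)%N;
  cc_depth : (1 <= m)%N;
  filt_top : forall l x, (m <= l)%N -> filt l x = fullv;
  filt_strict : forall l x, (1 <= l < m)%N ->
    (filt l x <= filt l.+1 x)%VS /\ filt l x <> filt l.+1 x;
  filt_rank : forall l x y, (1 <= l <= m)%N ->
    \dim (filt l x) = \dim (filt l y);
  filt_smooth : forall l x, (1 <= l <= m)%N ->
    exists (V : set cc_manifold)
           (Y : 'I_(\dim (filt l x)) -> cc_manifold -> 'rV[R]_N),
      [/\ open V, V x, forall j, Ck_vector_field k V (Y j) &
          forall y, V y ->
            filt l y = <<[seq Y j y | j <- enum 'I_(\dim (filt l x))]>>%VS];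
  filt_bracket : forall i j, (1 <= i <= m)%N -> (1 <= j <= m)%N ->
    forall (V : set cc_manifold) (X Y : cc_manifold -> 'rV[R]_N), open V ->
    Ck_vector_field k V X -> Ck_vector_field k V Y ->
    (forall x, V x -> X x \in filt i x) ->
    (forall x, V x -> Y x \in filt j x) ->
    forall x, V x -> lie_bracket X Y x \in filt (i + j) x }.

Section CanonicalCoordinates.
Context (R : realType) (N k m : nat) (M : cc_space R N k m).
Implicit Types (U : set M) (X : 'I_N -> M -> 'rV[R]_N).

Definition subordinate_basis U X : Prop :=
  [/\ open U,
      forall j, Ck_vector_field k U (X j),
      forall x, U x -> basis_of fullv [seq X j x | j <- enum 'I_N] &
      forall l x, (1 <= l <= m)%N -> U x ->
        filt l x =
          <<[seq X j x | j : 'I_N <- enum 'I_N & (j < \dim (filt l x))%N]>>%VS].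

(* The default value [m] is harmless since [filt m x] is the whole space. *)
Definition weight U X (j : 'I_N) : nat :=
  \big[minn/m]_(1 <= l < m.+1 | `[< forall x, U x -> X j x \in filt l x >]) l.

Definition canonical_coordinates U X (p : M) (theta : 'rV[R]_N -> M) : Prop :=
  nbhs (0 : 'rV[R]_N) [set u : 'rV[R]_N |
    is_exp U (fun x => \sum_(j < N) u 0 j *: X j x) p (theta u)].

End CanonicalCoordinates.

Section Dilations.
Context (R : realType) (N : nat) (sigma : 'I_N -> nat).

(* For [0 < e], the inverse of [dilation e] is [dilation e^-1]. *)
Definition dilation (e : R) (x : 'rV[R]_N) : 'rV[R]_N :=
  \row_j (e ^+ sigma j * x 0 j).

Definition Box (r : R) : set 'rV[R]_N :=
  [set x | \big[Num.max/0]_(j < N) (`|x 0 j| `^ (sigma j)%:R^-1) < r].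

End Dilations.

Definition homeomorphism (T : topologicalType) (f : T -> T) : Prop :=
  continuous f /\
  exists g : T -> T, [/\ cancel f g, cancel g f & continuous g].

(* Main.v *)
(* Write [psi = phi^-1 o theta]. Both statements amount to the bounds
   [|psi_k(delta_e x)| <= C e^sigma_k] for small [x] and [e]. Indeed, along the
   ray [t |-> t u] the map [theta] is an integral curve of [\sum_j u_j X_j], so
   expanding [psi] by iterated Lie derivatives gives a Taylor polynomial of
   degree [m] in [u], with a remainder which is small together with its first
   derivatives. Since weights are at least degrees and [sigma_k <= m], the
   bounds say that the terms of weight less than [sigma_k] in the [k]-th
   component vanish; the terms of weight [sigma_k] then form the limit [L], and
   [delta_e^-1 o psi o delta_e - L] has a Lipschitz constant tending to 0 near
   the origin. The rescaled maps all have the same Jacobian determinant at 0, so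
   [L] is invertible near 0, hence everywhere by homogeneity, and the inverse
   function theorem for Lipschitz perturbations of a linear map yields the
   inclusions of boxes. *)
Require Import Defs.
From HB Require Import structures.
From mathcomp Require Import all_boot all_order all_algebra.
From mathcomp Require Import all_classical all_reals all_analysis.
From mathcomp Require Import lra ring.
Set Implicit Arguments.
Unset Strict Implicit.
Unset Printing Implicit Defensive.
Import Order.TTheory GRing.Theory Num.Theory.
Import numFieldNormedType.Exports.
Local Open Scope classical_set_scope.
Local Open Scope ring_scope.

(** The obstacle is regularity: [theta] is only known to pick, for each small [u], the endpoint of
    some integral curve, and no smooth dependence on [u] is given. Gronwall's inequality restores
    what is needed: uniqueness, hence the ray identity; Lipschitz dependence; differentiability in
    [u]. The Taylor expansion does not come from higher derivatives of [psi] either: the expansion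
    of a function along rays is integrated from the expansions of its Lie derivatives, so only the
    transition map and the fields get differentiated repeatedly. All remainders are measured by
    their Lipschitz constant on the ball of radius [s]. This one quantity integrates along rays and,
    after rescaling, yields at once the uniform limit, the convergence of the Jacobian matrices and
    the contraction behind the inverse function theorem, without continuity of the derivative of
    [psi]. Terms of too low weight are removed one component and one point at a time: for fixed [x]
    they form a polynomial in [e] that is too small near 0 to be nonzero. *)

Lemma continuous_eps {R : realType} {V W : normedModType R} (f : V -> W) x :
  {for x, continuous f} <->
  forall e : R, 0 < e -> exists2 d, 0 < d &
    forall y, `|y - x| < d -> `|f y - f x| < e.
Proof.
split=> [/(@cvgrPdist_lt _ _ _ (nbhs x)) cf e e0|cf].
  have /nbhs_ballP[d /= d0 dP] := cf _ e0.
  exists d => // y yx; rewrite distrC; apply: dP.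
  by rewrite -ball_normE /= distrC.
apply/(@cvgrPdist_lt _ _ _ (nbhs x)) => e e0.
have [d d0 dP] := cf _ e0; apply/nbhs_ballP; exists d => //= y.
by rewrite -ball_normE /= distrC => /dP; rewrite distrC.
Qed.

(** * Row vectors and mean value inequalities *)

Section RowVectors.
Context {R : realType}.

Lemma row_norm_le n (x : 'rV[R]_n) c :
  0 <= c -> (forall i, `|x 0 i| <= c) -> `|x| <= c.
Proof.
move=> c0 xc; rewrite /Num.Def.normr /= mx_normrE; apply/bigmax_leP; split=> //.
by move=> [i j] _ /=; rewrite ord1.
Qed.

Lemma row_coord_le n (x : 'rV[R]_n) i : `|x 0 i| <= `|x|.
Proof.
rewrite [leRHS]/Num.Def.normr /= mx_normrE; apply/bigmax_geP; right => /=.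
by exists (0, i).
Qed.

Lemma row_norm_lt n (x : 'rV[R]_n) c :
  0 < c -> (forall i, `|x 0 i| < c) -> `|x| < c.
Proof.
move=> c0 xc; rewrite /Num.Def.normr /= mx_normrE; apply/bigmax_ltP; split=> //.
by move=> [i j] _ /=; rewrite ord1.
Qed.

Lemma norm_delta_row n (j : 'I_n) : `|delta_mx 0 j : 'rV[R]_n| = 1.
Proof.
apply/le_anti/andP; split.
  apply: row_norm_le => // i; rewrite mxE eqxx /=.
  by case: eqP => _; rewrite ?normr1 ?normr0.
by have := row_coord_le (delta_mx 0 j : 'rV[R]_n) j; rewrite mxE !eqxx normr1.
Qed.

Lemma linear_row_sum n (W : lmodType R) (f : {linear 'rV[R]_n -> W}) v :
  f v = \sum_j v 0 j *: f (delta_mx 0 j).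
Proof.
rewrite {1}[v]row_sum_delta linear_sum; apply: eq_bigr => j _.
by rewrite linearZ.
Qed.

Lemma norm_sum_rowZ n (W : normedModType R) (v : 'rV[R]_n) (F : 'I_n -> W) c :
  (forall j, `|F j| <= c) -> `|\sum_j v 0 j *: F j| <= n%:R * c * `|v|.
Proof.
move=> Fc; rewrite (le_trans (ler_norm_sum _ _ _))//.
apply: (@le_trans _ _ (\sum_(j < n) c * `|v|)); last first.
  by rewrite sumr_const card_ord -[leLHS]mulr_natl mulrA.
apply: ler_sum => j _; rewrite normrZ mulrC.
by apply: ler_pM => //; exact: row_coord_le.
Qed.

Lemma linear_row_bounded n (W : normedModType R) (f : {linear 'rV[R]_n -> W}) :
  exists2 K, 0 < K & forall v, `|f v| <= K * `|v|.
Proof.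
pose c := \sum_j `|f (delta_mx 0 j)|.
have c0 : 0 <= c by apply: sumr_ge0.
exists (n%:R * c + 1) => [|v]; first by rewrite ltr_wpDl// mulr_ge0.
rewrite linear_row_sum mulrDl mul1r -[leLHS]addr0 lerD//.
apply: norm_sum_rowZ => j.
by rewrite /c (bigD1 j)//= lerDl sumr_ge0.
Qed.

Lemma linear_row_continuous n (W : normedModType R)
    (f : {linear 'rV[R]_n -> W}) : continuous f.
Proof.
have [K K0 fK] := linear_row_bounded f.
move=> x; apply/continuous_eps => e e0; exists (e / K); first exact: divr_gt0.
move=> y xy; rewrite -linearB (le_lt_trans (fK _))// mulrC -ltr_pdivlMr//.
Qed.

End RowVectors.

Section DifferentiableEps.
Context {R : realType} {V W : normedModType R}.

Lemma differentiable_eps (f : V -> W) x (eta : R) :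
  differentiable f x -> 0 < eta ->
  exists2 d, 0 < d & forall h, `|h| < d ->
    `|f (x + h) - f x - 'd f x h| <= eta * `|h|.
Proof.
move=> /diff_locallyP[_ fE] eta0.
have /eqaddoP/(_ _ eta0)/nbhs_ballP[d /= d0 dP] := fE.
exists d => // h hd.
have := dP h; rewrite -ball_normE /= sub0r normrN => /(_ hd).
rewrite /=; congr (_ <= _); congr Num.norm.
by rewrite !fctE /= opprD addrA [h + x]addrC.
Qed.

Lemma eps_differentiable (f : V -> W) x (A : {linear V -> W}) :
  continuous A ->
  (forall eta : R, 0 < eta -> exists2 d, 0 < d & forall h, `|h| < d ->
    `|f (x + h) - f x - A h| <= eta * `|h|) ->
  differentiable f x /\ 'd f x = A :> (V -> W).
Proof.
move=> cA fA.
have fE : f \o shift x = cst (f x) + A +o_ 0 id.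
  apply/eqaddoP => eta eta0; have [d d0 dP] := fA _ eta0.
  apply/nbhs_ballP; exists d => //= h.
  rewrite -ball_normE /= sub0r normrN => /dP.
  by congr (_ <= _); congr Num.norm; rewrite !fctE /= opprD addrA [h + x]addrC.
have dE := diff_unique cA fE.
by split => //; apply/diff_locallyP; rewrite dE.
Qed.

Lemma near_eq_differentiable (f g : V -> W) x :
  (\near x, f x = g x) -> differentiable f x ->
  differentiable g x /\ 'd g x = 'd f x :> (V -> W).
Proof.
move=> fg df.
have fgx := nbhs_singleton fg.
apply: eps_differentiable => [|eta eta0]; first exact: diff_continuous.
have [d d0 dP] := differentiable_eps df eta0.
have /nbhs_ballP[d' /= d'0 d'P] := fg.
exists (Num.min d d'); first by rewrite lt_min d0.
move=> h; rewrite lt_min => /andP[hd hd'].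
rewrite -fgx -d'P; first exact: dP.
by rewrite -ball_normE /= opprD addNKr normrN.
Qed.

End DifferentiableEps.

Section MeanValue.
Context {R : realType}.

Lemma is_derive_coord n (f : R -> 'rV[R]_n) (t : R) v i :
  is_derive t (1 : R) f v -> is_derive t (1 : R) (fun s => f s 0 i) (v 0 i).
Proof.
move=> fv; have /derivable_mxP fm := @ex_derive _ _ _ _ _ _ _ fv.
apply: DeriveDef; first exact: fm.
have := @derive_val _ _ _ _ _ _ _ fv; rewrite derive_mx.
  by move=> <-; rewrite mxE.
exact/derivable_mxP.
Qed.

Lemma is_derive_continuous (W : normedModType R) (f : R -> W) (t : R) v :
  is_derive t (1 : R) f v -> {for t, continuous f}.
Proof.
move=> fv; apply: differentiable_continuous; apply/derivable1_diffP.
exact: ex_derive.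
Qed.

Lemma is_derive_curve_comp (V W : normedModType R) (s : R -> V) (f : V -> W)
    (t : R) v : is_derive t (1 : R) s v -> differentiable f (s t) ->
  is_derive t (1 : R) (f \o s) ('d f (s t) v).
Proof.
move=> sv df.
have ds : differentiable s t by apply/derivable1_diffP; exact: ex_derive.
have dfs : differentiable (f \o s) t by exact: differentiable_comp.
apply: DeriveDef; first exact/derivable1_diffP.
rewrite deriveE//.
have -> : 'd (f \o s) t 1 = 'd f (s t) ('d s t 1).
  exact: (congr1 (@^~ 1) (diff_comp ds df)).
by congr ('d f _ _); rewrite -deriveE//; exact: derive_val.
Qed.

Lemma is_derive_scale (W : normedModType R) (v : W) (t : R) :
  is_derive t (1 : R) (fun s : R => s *: v) v.
Proof.
have [dv vE] := is_diff_scalel t v.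
apply: DeriveDef; first exact/derivable1_diffP.
by rewrite deriveE//; have := congr1 (@^~ 1) vE; rewrite /= scale1r.
Qed.

(** The norm is the maximum of the coordinates, so the scalar mean value theorem in each coordinate
    gives the bound without a dimensional factor. *)
Lemma curve_mvt n (f df : R -> 'rV[R]_n) (b C : R) : 0 <= b -> 0 <= C ->
  (forall t, 0 <= t <= b -> is_derive t (1 : R) f (df t)) ->
  (forall t, 0 <= t <= b -> `|df t| <= C) ->
  `|f b - f 0| <= C * b.
Proof.
move=> b0 C0 fdf dfC; apply: row_norm_le; first exact: mulr_ge0.
move=> i; rewrite !mxE.
have fi t : 0 <= t <= b -> is_derive t (1 : R) (fun s => f s 0 i) (df t 0 i).
  by move=> /fdf /is_derive_coord.
have [| |c cb ->] :=
  @MVT_segment _ (fun s => f s 0 i) (fun s => df s 0 i) 0 b b0.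
- by move=> t /[!in_itv]/= /andP[t0 tb]; apply: fi; rewrite !ltW.
- apply: derivable_within_continuous => t; rewrite in_itv /= => tb.
  by apply: ex_derive; exact: fi.
move: cb; rewrite in_itv /= => cb.
rewrite subr0 normrM (ger0_norm b0) ler_wpM2r//.
exact: le_trans (row_coord_le _ _) (dfC _ cb).
Qed.

(* Small-constant Gronwall inequality: compare [|f|] with its maximum. *)
Lemma small_gronwall n (f df : R -> 'rV[R]_n) (K c : R) :
  0 <= K <= 2^-1 -> 0 <= c -> f 0 = 0 ->
  (forall t : R, 0 <= t <= 1 -> is_derive t (1 : R) f (df t)) ->
  (forall t : R, 0 <= t <= 1 -> `|df t| <= K * `|f t| + c) ->
  forall t : R, 0 <= t <= 1 -> `|f t| <= 2 * c.
Proof.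
move=> /andP[K0 K1] c0 f0 fdf dfK.
have cf : {within `[0, 1], continuous (fun t : R => `|f t| : R)}.
  apply: continuous_in_subspaceT => t /[!inE]/= /[!in_itv]/= t01.
  by apply: continuous_comp; [exact: is_derive_continuous (fdf t t01)|
    exact: norm_continuous].
have [s + smax] := EVT_max (@ler01 R) cf.
rewrite in_itv /= => s01.
have fs : `|f s| <= K * `|f s| + c.
  have KC : 0 <= K * `|f s| + c by rewrite addr_ge0 ?mulr_ge0.
  have := @curve_mvt n f df s (K * `|f s| + c).
  case/andP: (s01) => s0 s1.
  rewrite f0 subr0 => fsb; apply: (@le_trans _ _ ((K * `|f s| + c) * s)).
    apply: fsb => // t /andP[t0 ts].
      by apply: fdf; rewrite t0 (le_trans ts).
    have t01 : 0 <= t <= 1 by rewrite t0 (le_trans ts).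
    rewrite (le_trans (dfK _ t01))// lerD2r ler_wpM2l// smax// in_itv.
  by rewrite ler_piMr.
move=> t t01; have /smax ft : t \in `[0, 1] by rewrite in_itv.
have f0s : 0 <= `|f s| by [].
nra.
Qed.

End MeanValue.

(** * Calculus of C^k maps *)

Section CkCalculus.
Context {R : realType}.

Lemma diff_coord n q (f : 'rV[R]_n -> 'rV[R]_q) x i : differentiable f x ->
  differentiable (fun y => f y 0 i) x /\
  forall v, 'd (fun y => f y 0 i) x v = 'd f x v 0 i.
Proof.
move=> df.
have dc : differentiable (fun y : 'rV[R]_q => y 0 i) (f x).
  exact: differentiable_coord.
have dfi : differentiable (fun y => f y 0 i) x.
  exact: (@differentiable_comp _ _ _ _ f (fun y : 'rV[R]_q => y 0 i)).
split=> // v; rewrite -!deriveE// derive_mx; first by rewrite mxE.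
exact: diff_derivable.
Qed.

Lemma diff_row n q (f : 'rV[R]_n -> 'rV[R]_q) x :
  (forall i, differentiable (fun y => f y 0 i) x) -> differentiable f x.
Proof.
move=> df.
have -> : f = \sum_i (fun y => f y 0 i *: (delta_mx 0 i : 'rV[R]_q)).
  by apply/funext => y; rewrite fct_sumE -row_sum_delta.
by apply: differentiable_sum => i; apply: differentiableZl.
Qed.

(** Scalar factors appear as a coordinate of a vector-valued map because [Ck] speaks of maps between
    row vectors. Each coordinate of the product is then an ordinary product of functions. *)
Lemma diff_scale n p q (b : 'rV[R]_n -> 'rV[R]_p) (f : 'rV[R]_n -> 'rV[R]_q)
    i x : differentiable b x -> differentiable f x ->
  differentiable (fun y => b y 0 i *: f y) x /\
  forall v, 'd (fun y => b y 0 i *: f y) x v =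
    'd b x v 0 i *: f x + b x 0 i *: 'd f x v.
Proof.
move=> db df; have [dbi bE] := diff_coord i db.
have prodE j : (fun y => (b y 0 i *: f y) 0 j) =
    (fun y => b y 0 i) * (fun y => f y 0 j).
  by apply/funext => y; rewrite mxE.
have dbf : differentiable (fun y => b y 0 i *: f y) x.
  apply: diff_row => j; rewrite prodE.
  by apply: differentiableM => //; have [] := diff_coord j df.
split=> // v; apply/rowP => j.
have [dfj fE] := diff_coord j df.
have [_ <-] := diff_coord j dbf.
rewrite prodE diffM//.
transitivity (b x 0 i * 'd (fun y => f y 0 j) x v
  + f x 0 j * 'd (fun y => b y 0 i) x v); first by [].
by rewrite (fE v) (bE v) !mxE addrC; congr (_ + _); exact: mulrC.
Qed.

Lemma Ck_sub n q k (A B : set 'rV[R]_n) (f : 'rV[R]_n -> 'rV[R]_q) :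
  B `<=` A -> Ck k A f -> Ck k B f.
Proof.
move=> BA; elim: k f => /= [f fA x /BA/fA//|k IH f [fA dfA]].
by split=> [x /BA/fA//|v]; exact: IH.
Qed.

Lemma CkW n q k (A : set 'rV[R]_n) (f : 'rV[R]_n -> 'rV[R]_q) :
  Ck k.+1 A f -> Ck k A f.
Proof.
elim: k f => /= [f [fA _] x /fA|k IH f [fA dfA]].
  exact: differentiable_continuous.
by split=> // v; exact: IH.
Qed.

Lemma Ck_le n q k l (A : set 'rV[R]_n) (f : 'rV[R]_n -> 'rV[R]_q) :
  (k <= l)%N -> Ck l A f -> Ck k A f.
Proof. by move=> /subnK <-; elim: (l - k)%N => // j IH /CkW. Qed.

Lemma Ck_eq n q k (A : set 'rV[R]_n) (f g : 'rV[R]_n -> 'rV[R]_q) :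
  open A -> (forall x, A x -> f x = g x) -> Ck k A f -> Ck k A g.
Proof.
move=> oA; have near_fg f1 g1 x : (forall x, A x -> f1 x = g1 x) -> A x ->
    \near x, f1 x = g1 x :> 'rV[R]_q.
  by move=> fg Ax; apply: filterS fg _; exact: open_nbhs_nbhs.
elim: k f g => /= [f g fg fA x Ax|k IH f g fg [fA dfA]].
  have := fA _ Ax; rewrite /prop_for /continuous_at -fg// => fx.
  apply: cvg_trans fx.
  exact: (@near_eq_cvg _ _ (nbhs x) _ f g (near_fg _ _ _ fg Ax)).
split=> [x Ax|v].
  by have [] := near_eq_differentiable (near_fg _ _ _ fg Ax) (fA _ Ax).
apply: IH (dfA v) => x Ax.
have [_ E] := near_eq_differentiable (near_fg _ _ _ fg Ax) (fA _ Ax).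
exact: esym (congr1 (@^~ v) E).
Qed.

Lemma CkD n q k (A : set 'rV[R]_n) (f g : 'rV[R]_n -> 'rV[R]_q) :
  open A -> Ck k A f -> Ck k A g -> Ck k A (f + g).
Proof.
move=> oA; elim: k f g => /= [f g fA gA x Ax|k IH f g [fA dfA] [gA dgA]].
  exact: (@continuousD _ _ _ f g x (fA _ Ax) (gA _ Ax)).
split=> [x Ax|v]; first by apply: differentiableD; [exact: fA|exact: gA].
apply: Ck_eq (IH _ _ (dfA v) (dgA v)) => // x Ax.
exact: esym (congr1 (@^~ v) (diffD (fA _ Ax) (gA _ Ax))).
Qed.

Lemma Ck_cst n q k (A : set 'rV[R]_n) (c : 'rV[R]_q) :
  Ck k A (fun=> c : 'rV[R]_q).
Proof.
elim: k c => /= [c x _|k IH c]; first exact: cst_continuous.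
split=> [x _|v]; first exact: differentiable_cst.
rewrite [X in Ck _ _ X](_ : _ = fun=> 0); first exact: IH.
by apply/funext => x; exact: (congr1 (@^~ v) (diff_cst c x)).
Qed.

Lemma Ck_id n k (A : set 'rV[R]_n) : Ck k A (fun x : 'rV[R]_n => x).
Proof.
case: k => /= [x _|k]; first exact: cvg_id.
split=> [x _|v].
  apply: (@linear_differentiable _ _ _ (@idfun 'rV[R]_n)) => y.
  exact: cvg_id.
rewrite [X in Ck _ _ X](_ : _ = fun=> v); first exact: Ck_cst.
apply/funext => x.
apply: (congr1 (@^~ v) (@diff_lin _ _ _ (@idfun 'rV[R]_n) x _)).
by move=> y; exact: cvg_id.
Qed.

Lemma Ck_sum n q k (A : set 'rV[R]_n) I (r : seq I)
    (f : I -> 'rV[R]_n -> 'rV[R]_q) :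
  open A -> (forall i, Ck k A (f i)) -> Ck k A (fun x => \sum_(i <- r) f i x).
Proof.
move=> oA fA; elim: r => [|i r IH].
  by apply: Ck_eq (Ck_cst k A 0) => // x _; rewrite big_nil.
by apply: Ck_eq (CkD oA (fA i) IH) => // x _; rewrite big_cons.
Qed.

Lemma Ck_scale n p q k (A : set 'rV[R]_n) (b : 'rV[R]_n -> 'rV[R]_p)
    (f : 'rV[R]_n -> 'rV[R]_q) i :
  open A -> Ck k A b -> Ck k A f -> Ck k A (fun x => b x 0 i *: f x).
Proof.
move=> oA; elim: k b f => /= [b f bA fA x Ax|k IH b f bA fA].
  apply: (@continuousZ _ _ _ (fun x => b x 0 i) f x); last exact: fA.
  apply: (@continuous_comp _ _ _ b (fun y : 'rV[R]_p => y 0 i)).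
    exact: bA.
  exact: coord_continuous.
have [[dbA Db] [dfA Df]] := (bA, fA).
split=> [x Ax|v]; first by have [] := diff_scale i (dbA _ Ax) (dfA _ Ax).
have Ck1 : Ck k A (fun x => 'd b x v 0 i *: f x).
  by apply: IH; [exact: Db|exact: CkW (conj dfA Df)].
have Ck2 : Ck k A (fun x => b x 0 i *: 'd f x v).
  by apply: IH; [exact: CkW (conj dbA Db)|exact: Df].
apply: Ck_eq (CkD oA Ck1 Ck2) => // x Ax.
have [_ E] := diff_scale i (dbA _ Ax) (dfA _ Ax).
exact: esym (E v).
Qed.

(** A Lie derivative costs one derivative of [f] and none of [Y]. Since [Ck] tests the derivative
    along fixed vectors, [Y] is first expanded in the standard basis. *)
Lemma Ck_lie n q k (A : set 'rV[R]_n) (f : 'rV[R]_n -> 'rV[R]_q)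
    (Y : 'rV[R]_n -> 'rV[R]_n) :
  open A -> Ck k.+1 A f -> Ck k A Y -> Ck k A (fun x => 'd f x (Y x)).
Proof.
move=> oA [_ Df] YA.
have Ck1 : Ck k A (fun x => \sum_j Y x 0 j *: 'd f x (delta_mx 0 j)).
  apply: Ck_sum => // j.
  exact: (Ck_scale (f := fun x => 'd f x (delta_mx 0 j)) j oA YA (Df _)).
apply: Ck_eq Ck1 => // x _.
exact: esym (linear_row_sum ('d f x) (Y x)).
Qed.

End CkCalculus.

(** * Strict differentiability and uniform first-order estimates *)

Section StrictDifferentiability.
Context {R : realType}.

(** Both points vary, so that [f - A] has arbitrarily small Lipschitz constants near [x]; this is
    the order-one model of the estimates required of Taylor remainders later. *)
Definition strict_diff n q (f : 'rV[R]_n -> 'rV[R]_q) x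
    (A : 'rV[R]_n -> 'rV[R]_q) : Prop :=
  forall eta : R, 0 < eta -> exists2 d, 0 < d &
    forall y z, `|y - x| < d -> `|z - x| < d ->
      `|f y - f z - A (y - z)| <= eta * `|y - z|.

Lemma strict_diff_lipschitz n q (f : 'rV[R]_n -> 'rV[R]_q) x
    (A : {linear 'rV[R]_n -> 'rV[R]_q}) : strict_diff f x A ->
  exists K d : R, [/\ 0 < K, 0 < d & forall y z, `|y - x| < d -> `|z - x| < d ->
      `|f y - f z| <= K * `|y - z|].
Proof.
move=> fA; have [d d0 dP] := fA 1 ltr01.
have [K K0 KP] := linear_row_bounded A.
exists (K + 1), d; split=> [||y z yd zd]; rewrite ?addr_gt0//.
rewrite -(subrK (A (y - z)) (f y - f z)) (le_trans (ler_normD _ _))//.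
by rewrite mulrDl addrC lerD// dP.
Qed.

(** Mean value inequality for [f - 'd f x] along the segment from [z] to [y]. Continuity of the
    derivative is available along fixed vectors, so [eta] is shared among the basis vectors; [n.+1]
    avoids a division by zero in dimension 0. *)
Lemma C1_strict n q (A : set 'rV[R]_n) (f : 'rV[R]_n -> 'rV[R]_q) x :
  open A -> A x -> Ck 1 A f -> strict_diff f x ('d f x).
Proof.
move=> oA Ax [dfA Df] eta eta0.
have n0 : 0 < n.+1%:R :> R by [].
have ne0 : 0 < eta / n.+1%:R by rewrite divr_gt0.
have nA : nbhs x A by exact: open_nbhs_nbhs.
have nD : nbhs x [set w |
    forall j, `|'d f w (delta_mx 0 j) - 'd f x (delta_mx 0 j)| < eta / n.+1%:R].
  suff nDj j : nbhs x [set w | `|'d f w (delta_mx 0 j) -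
      'd f x (delta_mx 0 j)| < eta / n.+1%:R].
    exact: (@filter_forall _ _ _ (nbhs x) _ nDj).
  have /continuous_eps/(_ _ ne0)[d d0 dP] := Df (delta_mx 0 j) _ Ax.
  apply/nbhs_ballP; exists d => //= w; rewrite -ball_normE /= distrC.
  exact: dP.
have [d /= d0 dP] := (nbhs_ballP _ _).1 (@filterI _ (nbhs x) _ _ _ nA nD).
exists d => // y z yd zd.
pose s (t : R) := z + t *: (y - z).
have sd (t : R) : 0 <= t <= 1 -> ball x d (s t).
  move=> /andP[t0 t1]; rewrite -ball_normE /= distrC /s.
  have -> : z + t *: (y - z) - x = (1 - t) *: (z - x) + t *: (y - x).
    by apply/rowP => i; rewrite !mxE; ring.
  rewrite (le_lt_trans (ler_normD _ _))// !normrZ !ger0_norm ?subr_ge0//.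
  by have [zy|yz] := leP `|z - x| `|y - x|; nra.
have sE (t : R) : is_derive t (1 : R) s (y - z).
  have := is_deriveD (is_derive_cst z t (1 : R)) (is_derive_scale (y - z) t).
  by rewrite add0r.
pose g (t : R) := f (s t) - t *: 'd f x (y - z).
have gE (t : R) : 0 <= t <= 1 ->
    is_derive t (1 : R) g ('d f (s t) (y - z) - 'd f x (y - z)).
  move=> /sd/dP[As _].
  have := is_deriveB (is_derive_curve_comp (sE t) (dfA _ As))
    (is_derive_scale ('d f x (y - z)) t).
  by [].
have := @curve_mvt _ _ g _ 1 (eta * `|y - z|) ler01 _ gE.
have -> : g 1 - g 0 = f y - f z - 'd f x (y - z).
  by rewrite /g /s !scale0r !scale1r addr0 subr0 subrKC addrAC.
rewrite mulr1; apply; first by rewrite mulr_ge0// ltW.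
move=> t /sd/dP[As sj].
have -> : 'd f (s t) (y - z) - 'd f x (y - z) = \sum_j (y - z) 0 j *:
    ('d f (s t) (delta_mx 0 j) - 'd f x (delta_mx 0 j)).
  under eq_bigr do rewrite scalerBr.
  rewrite sumrB; congr (_ - _); first exact: (linear_row_sum ('d f (s t))).
  exact: (linear_row_sum ('d f x)).
rewrite (le_trans (norm_sum_rowZ _ (fun j => ltW (sj j))))//.
rewrite ler_wpM2r// mulrCA ger_pMr// ler_pdivrMr// mul1r ler_nat//.
Qed.

End StrictDifferentiability.

(** Makes row vectors a complete normed module, where Cauchy difference quotients converge and
    Banach's fixed point theorem applies. *)
HB.instance Definition _ (R : realType) m n := Complete.on 'M[R]_(m, n).

Section DerivativeBounds.
Context {R : realType}.

(** The differential is homogeneous, so it is compared with the increment of [f] on a short multiple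
    of [v], where the first-order error is negligible. *)
Lemma diff_lipschitz_le (V W : normedModType R) (f : V -> W) x (K d : R) :
  differentiable f x -> 0 <= K -> 0 < d ->
  (forall h, `|h| < d -> `|f (x + h) - f x| <= K * `|h|) ->
  forall v, `|'d f x v| <= K * `|v|.
Proof.
move=> df K0 d0 fK v; apply/ler_addgt0Pr => e e0.
have v1 : 0 < `|v| + 1 by rewrite ltr_wpDl.
have e1 : 0 < e / (`|v| + 1) by rewrite divr_gt0.
have [d' d'0 dP] := differentiable_eps df e1.
(* Adding 1 covers [v = 0]; the vector [s *: v] is then shorter than both radii. *)
pose s := Num.min d d' / (`|v| + 1) / 2.
have m0 : 0 < Num.min d d' by rewrite lt_min d0.
have s0 : 0 < s by rewrite !divr_gt0.
have svm : `|s *: v| < Num.min d d'.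
  have q1 : `|v| / (`|v| + 1) <= 1 by rewrite ler_pdivrMr//; lra.
  have q0 : 0 <= `|v| / (`|v| + 1) by rewrite divr_ge0// ltW.
  rewrite normrZ gtr0_norm//.
  have -> : s * `|v| = Num.min d d' * (`|v| / (`|v| + 1)) / 2.
    by rewrite /s; ring.
  nra.
have [svd svd'] : `|s *: v| < d /\ `|s *: v| < d'.
  by move: svm; rewrite lt_min => /andP.
move: (s) s0 svd svd' => {svm}{}s s0 svd svd'.
have : `|'d f x (s *: v)| <= K * `|s *: v| + e / (`|v| + 1) * `|s *: v|.
  rewrite -(subKr (f (x + s *: v) - f x) ('d f x (s *: v))).
  by rewrite (le_trans (ler_normB _ _))// lerD ?fK ?dP.
rewrite linearZ !normrZ gtr0_norm// mulrCA (mulrCA (e / _)) -mulrDr.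
rewrite ler_pM2l// => /le_trans; apply; rewrite lerD2l.
rewrite -[leRHS]mulr1 -mulrA ler_wpM2l ?(ltW e0)//.
by rewrite ler_pdivrMl// mulr1; nra.
Qed.

(** A single radius serves all base points near [y]: there [f - A] has Lipschitz constant [eta / 2],
    so at each such [x] both the increment and the differential of [f] stay within [eta / 2] of
    [A]. *)
Lemma strict_diff_near n q (f : 'rV[R]_n -> 'rV[R]_q) y
    (A : {linear 'rV[R]_n -> 'rV[R]_q}) (eta : R) :
  strict_diff f y A -> 0 < eta ->
  exists2 d, 0 < d & forall x, `|x - y| < d -> differentiable f x ->
    (forall v, `|'d f x v - A v| <= eta * `|v|) /\
    forall h, `|h| < d -> `|f (x + h) - f x - 'd f x h| <= eta * `|h|.
Proof.
move=> fA eta0; have eta2 : 0 < eta / 2 by rewrite divr_gt0.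
have [d d0 dP] := fA _ eta2.
have d2 : 0 < d / 2 by rewrite divr_gt0.
exists (d / 2) => // x xy df.
have xyd : `|x - y| < d by lra.
have xhd h : `|h| < d / 2 -> `|x + h - y| < d.
  move=> hd; rewrite addrAC (le_lt_trans (ler_normD _ _))//; lra.
have est h : `|h| < d / 2 -> `|f (x + h) - f x - A h| <= eta / 2 * `|h|.
  by move=> hd; have := dP _ _ (xhd _ hd) xyd; rewrite [x + h]addrC addrK.
have cA : continuous A by exact: linear_row_continuous.
have dA := linear_differentiable x cA.
pose g := f - (A : _ -> _).
have dg : differentiable g x by exact: differentiableB.
have dgE v : 'd g x v = 'd f x v - A v.
  rewrite -[A v](congr1 (@^~ v) (diff_lin x cA)).
  exact: (congr1 (@^~ v) (diffB df dA)).
have dfA v : `|'d f x v - A v| <= eta / 2 * `|v|.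
  rewrite -dgE; apply: (diff_lipschitz_le dg (ltW eta2) d2) => h hd.
  have -> : g (x + h) - g x = f (x + h) - f x - A h.
    rewrite /g !fctE linearD; apply/rowP => i; rewrite !mxE; ring.
  exact: est.
split=> [v|h hd].
  by rewrite (le_trans (dfA v))// ler_wpM2r//; lra.
have -> : f (x + h) - f x - 'd f x h =
    (f (x + h) - f x - A h) - ('d f x h - A h).
  by apply/rowP => i; rewrite !mxE; ring.
rewrite (le_trans (ler_normB _ _))// [eta]splitr mulrDl lerD//.
exact: est.
Qed.

Lemma dnbhs0_norm_lt (d : R) : 0 < d -> \forall s \near (0 : R)^', 0 < `|s| < d.
Proof.
move=> d0; near=> s; apply/andP; split.
  by rewrite normr_gt0; near: s; exact: nbhs_dnbhs_neq.
by near: s; exact: dnbhs0_lt.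
Unshelve. all: by end_near. Qed.

Lemma is_cvg_dnbhs_cauchy (W : completeNormedModType R) (f : R -> W) :
  (forall e : R, 0 < e -> exists2 d, 0 < d & forall s t : R,
     0 < `|s| < d -> 0 < `|t| < d -> `|f s - f t| <= e) ->
  cvg (f s @[s --> 0^']).
Proof.
move=> fc; apply/cauchy_cvgP/cauchy_ballP => e e0.
have e2 : 0 < e / 2 by rewrite divr_gt0.
have [d d0 dP] := fc _ e2.
have nd := dnbhs0_norm_lt d0.
pose S := f @` [set s | 0 < `|s| < d].
have nS : nbhs (f s @[s --> 0^']) S.
  by apply: filterS nd => s sd; exists s.
exists (S, S) => // -[_ _] [[s sd <-] [t td <-]]; rewrite -ball_normE /=.
by rewrite (le_lt_trans (dP _ _ sd td))//; lra.
Qed.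

(* The criterion compares increments with difference quotients only, so that
   no candidate for the derivative is needed. *)
Lemma differentiable_criterion n q (f : 'rV[R]_n -> 'rV[R]_q) x :
  (forall eta : R, 0 < eta -> exists2 d, 0 < d & forall h (s : R),
    `|h| < d -> 0 < `|s| < d ->
    `|f (x + h) - f x -
      \sum_j h 0 j *: (s^-1 *: (f (x + s *: delta_mx 0 j) - f x))|
      <= eta * `|h|) ->
  differentiable f x.
Proof.
move=> fP; pose quot j (s : R) := s^-1 *: (f (x + s *: delta_mx 0 j) - f x).
have quot_cvg j : cvg (quot j s @[s --> 0^']).
  apply: is_cvg_dnbhs_cauchy => e e0; have [d d0 dP] := fP _ e0.
  exists d => // s t /andP[s0 sd] td.
  (* For [h] equal to [s] times a basis vector the sum reduces to one quotient at [t], and the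
     estimate divided by [s] is the Cauchy condition. *)
  have := dP (s *: delta_mx 0 j) t.
  rewrite normrZ norm_delta_row mulr1 => /(_ sd td).
  rewrite (bigD1 j)//= big1 => [|i /negPf ij]; last first.
    by rewrite !mxE ij mulr0 scale0r.
  rewrite !mxE !eqxx mulr1 addr0 => E.
  have sn0 : s != 0 by rewrite -normr_gt0.
  rewrite -(ler_pM2l s0) -normrZ scalerBr {1}/quot scalerA divff// scale1r.
  by rewrite mulrC.
pose M := \matrix_j lim (quot j s @[s --> 0^']).
have [] // := @eps_differentiable _ _ _ f x (mulmxr M).
  exact: linear_row_continuous.
move=> eta eta0.
have n1 : 0 < n.+1%:R :> R by [].
have e1 : 0 < eta / n.+1%:R by rewrite divr_gt0.
have [d d0 dP] := fP _ e1; exists d => // h hd.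
have nq : \forall s \near 0^',
    forall j, `|lim (quot j s @[s --> 0^']) - quot j s| < eta / n.+1%:R.
  apply: filter_forall => j; have /cvgrPdist_lt := quot_cvg j.
  exact.
have nd := dnbhs0_norm_lt d0.
have [s [sq sd]] := @filter_ex _ (0 : R)^' _ _ (filterI nq nd).
suff : `|f (x + h) - f x - h *m M| <= eta * `|h| by [].
have -> : h *m M = \sum_j h 0 j *: lim (quot j s @[s --> 0^']).
  by rewrite mulmx_sum_row; apply: eq_bigr => j _; rewrite rowK.
have -> : \sum_j h 0 j *: lim (quot j s @[s --> 0^']) =
    \sum_j h 0 j *: quot j s +
    \sum_j h 0 j *: (lim (quot j s @[s --> 0^']) - quot j s).
  by rewrite -big_split; apply: eq_bigr => j _; rewrite /= -scalerDr subrKC.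
rewrite opprD addrA.
rewrite (le_trans (ler_normB _ _))//.
have := norm_sum_rowZ h (fun j => ltW (sq j)).
move: (dP h s hd sd); rewrite -/(quot _ _) => H1 H2.
rewrite (le_trans (lerD H1 H2))// -mulrDl ler_wpM2r//.
by rewrite -[X in X + _]mul1r -mulrDl nat1r mulrC divfK// gt_eqF.
Qed.

End DerivativeBounds.

(** * Dependence of integral curves on their coefficients *)

Section RayFlow.
Context {R : realType} {N : nat}.
Implicit Types (Y : 'I_N -> 'rV[R]_N -> 'rV[R]_N) (u v y z : 'rV[R]_N) (t : R).

Definition field_comb Y u y : 'rV[R]_N := \sum_j u 0 j *: Y j y.

Lemma field_combD Y u v y :
  field_comb Y (u + v) y = field_comb Y u y + field_comb Y v y.
Proof.
by rewrite -big_split; apply: eq_bigr => j _; rewrite /= mxE scalerDl.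
Qed.

Lemma field_combZ Y (a : R) u y :
  field_comb Y (a *: u) y = a *: field_comb Y u y.
Proof.
by rewrite scaler_sumr; apply: eq_bigr => j _; rewrite mxE scalerA.
Qed.

Lemma field_combB Y u v y :
  field_comb Y (u - v) y = field_comb Y u y - field_comb Y v y.
Proof. by rewrite field_combD -scaleN1r field_combZ scaleN1r. Qed.

(* [c u t] is the integral curve of [field_comb Y u] from [y0]; all curves with
   [`|u| < r0] stay in the ball of radius [r], and [K * r0 <= 1/2] makes
   [small_gronwall] applicable to them. *)
Record ray_flow Y y0 (r r0 B K : R) (c : 'rV[R]_N -> R -> 'rV[R]_N) : Prop :=
  RayFlow {
  rf_r0 : 0 < r0;
  rf_B : 0 < B;
  rf_K : 0 < K;
  rf_small : K * r0 <= 2^-1;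
  rf_bound : forall u y, `|y - y0| < r -> `|field_comb Y u y| <= B * `|u|;
  rf_lip : forall u y z, `|y - y0| < r -> `|z - y0| < r ->
    `|field_comb Y u y - field_comb Y u z| <= K * `|u| * `|y - z|;
  rf_start : forall u, `|u| < r0 -> c u 0 = y0;
  rf_in : forall u t, `|u| < r0 -> 0 <= t <= 1 -> `|c u t - y0| < r;
  rf_ode : forall u t, `|u| < r0 -> 0 <= t <= 1 ->
    is_derive t (1 : R) (c u) (field_comb Y u (c u t));
  rf_ray : forall u t, `|u| < r0 -> 0 <= t <= 1 -> c u t = c (t *: u) 1 }.

Section Theory.
Context {Y : 'I_N -> 'rV[R]_N -> 'rV[R]_N} {y0 : 'rV[R]_N} {r r0 B K : R}
  {c : 'rV[R]_N -> R -> 'rV[R]_N} (F : ray_flow Y y0 r r0 B K c).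

Let small u : `|u| < r0 -> 0 <= K * `|u| <= 2^-1.
Proof.
move=> ur; have K0 := rf_K F; rewrite mulr_ge0 ?(ltW K0)//=.
by rewrite (le_trans _ (rf_small F))// ler_wpM2l// ltW.
Qed.

(** The velocities differ by a change of point, which Gronwall absorbs with the constant [K] times
    [|u|], and by a change of coefficients, which costs at most [B] times [|u - v|]. *)
Lemma flow_lipschitz u v t : `|u| < r0 -> `|v| < r0 -> 0 <= t <= 1 ->
  `|c u t - c v t| <= 2 * B * `|u - v|.
Proof.
move=> ur vr t01; have B0 := rf_B F; rewrite -mulrA.
pose df s := field_comb Y u (c u s) - field_comb Y v (c v s).
apply: (@small_gronwall _ _ (c u - c v) df (K * `|u|)) => //.
- exact: small.
- by rewrite mulr_ge0// ltW.
- by rewrite !fctE !(rf_start F)// subrr.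
- by move=> s s01; apply: is_deriveB; exact: (rf_ode F).
move=> s s01; have cu := rf_in F ur s01; have cv := rf_in F vr s01.
have -> : df s = (field_comb Y u (c u s) - field_comb Y u (c v s))
    + field_comb Y (u - v) (c v s).
  by rewrite field_combB /df addrA subrK.
rewrite (le_trans (ler_normD _ _))// lerD//; first exact: (rf_lip F).
exact: (rf_bound F).
Qed.

Lemma flow_dist u t : `|u| < r0 -> 0 <= t <= 1 ->
  `|c u t - y0| <= 2 * B * `|u|.
Proof.
move=> ur t01; have z0 : `|0 : 'rV[R]_N| < r0 by rewrite normr0 (rf_r0 F).
have /flow_lipschitz/(_ z0 t01) := ur; rewrite subr0.
(* The ray identity, used at the times [t] and 0, shows that the curve with zero coefficients is
   constant. *)
by rewrite (rf_ray F z0 t01) scaler0 -(scale0r (0 : 'rV_N))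
  -(rf_ray F z0) ?lexx ?ler01// (rf_start F).
Qed.

(** Strict differentiability of the flow at the origin with a rate linear in [s]. The time
    derivative of the deviation splits into two terms, one moving the point under the coefficients
    [u], one moving it from [y0] under [u - v]; each is at most [K] times [2 * B], which explains
    the constant. *)
Lemma flow_strict_diff0 : exists C : R, 0 <= C /\
  forall (s : R) u v t, `|u| <= s -> `|v| <= s -> s < r0 -> 0 <= t <= 1 ->
    `|(c u t - t *: field_comb Y u y0) - (c v t - t *: field_comb Y v y0)|
      <= C * s * `|u - v|.
Proof.
have B0 := rf_B F; have K0 := rf_K F.
have r_gt0 : 0 < r.
  have z0 : `|0 : 'rV[R]_N| < r0 by rewrite normr0 (rf_r0 F).
  have := rf_in F z0 (t := 0); rewrite lexx ler01 => /(_ isT).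
  exact: le_lt_trans.
exists (4 * B * K); split; first by rewrite !mulr_ge0// ltW.
move=> s u v t us vs sr t01.
have [ur vr] : `|u| < r0 /\ `|v| < r0 by split; exact: le_lt_trans sr.
have s0 : 0 <= s by exact: le_trans us.
pose g a : 'rV[R]_N :=
  (c u a - a *: field_comb Y u y0) - (c v a - a *: field_comb Y v y0).
pose dg a := (field_comb Y u (c u a) - field_comb Y u y0)
           - (field_comb Y v (c v a) - field_comb Y v y0).
have gE (a : R) : 0 <= a <= 1 -> is_derive a (1 : R) g (dg a).
  move=> a01; apply: is_deriveB; apply: is_deriveB.
  - exact: (rf_ode F).
  - exact: is_derive_scale.
  - exact: (rf_ode F).
  - exact: is_derive_scale.
have g0 : g 0 = 0.
  by rewrite /g !scale0r !subr0 !(rf_start F)// subrr.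
have [t0 t1] := andP t01.
have := @curve_mvt _ _ g dg t (4 * B * K * s * `|u - v|) t0.
rewrite g0 subr0 => H; apply: le_trans (H _ _ _) _.
- by rewrite !mulr_ge0// ltW.
- by move=> a /andP[a0 at1]; apply: gE; rewrite a0 (le_trans at1).
- move=> a /andP[a0 at1]; have a01 : 0 <= a <= 1 by rewrite a0 (le_trans at1).
  have cu := rf_in F ur a01; have cv := rf_in F vr a01.
  have -> : dg a = (field_comb Y u (c u a) - field_comb Y u (c v a))
      + (field_comb Y (u - v) (c v a) - field_comb Y (u - v) y0).
    rewrite !field_combB /dg; apply/rowP => i; rewrite !mxE; ring.
  rewrite (le_trans (ler_normD _ _))//.
  have y00 : `|y0 - y0| < r by rewrite subrr normr0.
  have h1 := rf_lip F u cu cv.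
  have h2 := rf_lip F (u - v) cv y00.
  have h3 := flow_lipschitz ur vr a01.
  have h4 := flow_dist vr a01.
  have e1 : K * `|u| * `|c u a - c v a| <= K * s * (2 * B * `|u - v|).
    by apply: ler_pM => //; [rewrite mulr_ge0// ltW|rewrite ler_wpM2l// ltW].
  have e2 : K * `|u - v| * `|c v a - y0| <= K * `|u - v| * (2 * B * s).
    rewrite ler_wpM2l ?mulr_ge0 ?(ltW K0)// (le_trans h4)// ler_wpM2l//.
    by rewrite mulr_ge0// ltW.
  rewrite (le_trans (lerD h1 h2))// (le_trans (lerD e1 e2))//.
  by rewrite le_eqVlt; apply/orP; left; apply/eqP; ring.
- by rewrite ler_piMr// !mulr_ge0// ltW.
Qed.

Context (Yd : forall u y, `|y - y0| < r ->
  differentiable (field_comb Y u) y /\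
  strict_diff (field_comb Y u) y ('d (field_comb Y u) y)).

(** Strict differentiability at the point reached at time [t] gives a radius that also works at
    neighbouring times; compactness of the unit interval extracts a common one. *)
Lemma flow_uniform_diff u (eta : R) : `|u| < r0 -> 0 < eta ->
  exists2 d, 0 < d & forall t h, 0 <= t <= 1 -> `|h| < d ->
    `|field_comb Y u (c u t + h) - field_comb Y u (c u t)
      - 'd (field_comb Y u) (c u t) h| <= eta * `|h|.
Proof.
move=> ur eta0.
pose P (d t : R) := 0 <= t <= 1 -> forall h, `|h| < d ->
    `|field_comb Y u (c u t + h) - field_comb Y u (c u t)
      - 'd (field_comb Y u) (c u t) h| <= eta * `|h|.
have : \forall d \near (0 : R)^'+, `[0, 1] `<=` P d.
  have /compact_near_coveringP := @segment_compact R 0 1.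
  apply => t; rewrite /= in_itv /= => t01.
  have [_ sd] := Yd u (rf_in F ur t01).
  have [d d0 dP] := strict_diff_near sd eta0.
  have ct := is_derive_continuous (rf_ode F ur t01).
  have /continuous_eps/(_ _ d0)[d' d'0 d'P] := ct.
  exists (ball t d', [set e | e < d]) => /=.
    split; first exact: nbhsx_ballx.
    exact: nbhs_right_lt.
  move=> [s e] [/= ts ed] s01 h he.
  have sd' : `|s - t| < d' by move: ts; rewrite -ball_normE /= distrC.
  have [dx _] := Yd u (rf_in F ur s01).
  have [_] := dP _ (d'P _ sd') dx; apply.
  exact: lt_trans ed.
move=> dP; have [d [d0 dP']] := @filter_ex _ (0 : R)^'+ _ _
  (filterI (nbhs_right_gt (0 : R)) dP).
by exists d => // t h t01; apply: dP'; rewrite //= in_itv.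
Qed.

(** No solution of the linearized equation has to be constructed: the increment for [h], minus the
    combination of difference quotients, starts at 0 and solves that equation up to an error of
    order [eta] times [|h|], so Gronwall bounds it and the criterion applies. *)
Lemma flow_differentiable u : `|u| < r0 ->
  differentiable (fun w => c w 1) u.
Proof.
move=> ur; apply: differentiable_criterion => eta eta0.
have B0 := rf_B F; have K0 := rf_K F.
(* Two errors of size [eta / k] times [2 * B] make up [e1 / 2]; [N.+1] such contributions amount to
   [eta / 4], and Gronwall doubles this. *)
pose k : R := 16 * N.+1%:R * B.
have k0 : 0 < k by rewrite !mulr_gt0.
have eta1 : 0 < eta / k by rewrite divr_gt0.
have [d1 d10 d1P] := flow_uniform_diff ur eta1.
pose d := Num.min (r0 - `|u|) (Num.min (d1 / (2 * B)) (eta / (k * K))).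
have d0 : 0 < d by rewrite !lt_min subr_gt0 ur !divr_gt0 ?mulr_gt0.
(* Error made when the increment of the velocity is replaced by its linearization along the curve
   [c u]. *)
pose E h t := (field_comb Y (u + h) (c (u + h) t) - field_comb Y u (c u t))
  - ('d (field_comb Y u) (c u t) (c (u + h) t - c u t)
     + field_comb Y h (c u t)).
pose e1 : R := eta / (2 * N.+1%:R).
have uhr h : `|h| < d -> `|u + h| < r0.
  rewrite !lt_min => /andP[h0 _]; rewrite (le_lt_trans (ler_normD _ _))//; lra.
have EP h t : `|h| < d -> 0 <= t <= 1 -> `|E h t| <= e1 / 2 * `|h|.
  move=> hd t01; have uh := uhr h hd.
  move: hd; rewrite !lt_min => /and3P[_ h1 h2].
  have cuh := rf_in F uh t01; have cu := rf_in F ur t01.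
  have := flow_lipschitz uh ur t01.
  rewrite [u + h - u]addrAC subrr add0r => lip.
  have h3 : `|c (u + h) t - c u t| < d1.
    by rewrite (le_lt_trans lip)// mulrC -ltr_pdivlMr// mulr_gt0.
  have := d1P t _ t01 h3; rewrite [c u t + _]addrC subrK => h4.
  have h5 := rf_lip F h cuh cu.
  have -> : E h t = (field_comb Y u (c (u + h) t) - field_comb Y u (c u t)
      - 'd (field_comb Y u) (c u t) (c (u + h) t - c u t))
      + (field_comb Y h (c (u + h) t) - field_comb Y h (c u t)).
    by rewrite /E field_combD; apply/rowP => i; rewrite !mxE; ring.
  rewrite (le_trans (ler_normD _ _))//.
  have e2 : eta / k * `|c (u + h) t - c u t| <= eta / k * (2 * B * `|h|).
    by rewrite ler_wpM2l// ltW.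
  have e3 : K * `|h| * `|c (u + h) t - c u t| <=
      K * (eta / (k * K)) * (2 * B * `|h|).
    apply: ler_pM => //; first by rewrite mulr_ge0// ltW.
    by rewrite ler_wpM2l ?(ltW K0)// ltW.
  rewrite (le_trans (lerD h4 h5))// (le_trans (lerD e2 e3))//.
  rewrite le_eqVlt; apply/orP; left; apply/eqP.
  rewrite /e1 /k; field.
  by rewrite (gt_eqF B0) (gt_eqF K0) nat1r pnatr_eq0.
exists d => // h s hd /andP[s0 sd].
have sn0 : s != 0 by rewrite -normr_gt0.
pose D t := (c (u + h) t - c u t) - \sum_j h 0 j *:
   (s^-1 *: (c (u + s *: delta_mx 0 j) t - c u t)).
have sjd (j : 'I_N) : `|s *: (delta_mx 0 j : 'rV[R]_N)| < d.
  by rewrite normrZ norm_delta_row mulr1.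
pose inc h t := field_comb Y (u + h) (c (u + h) t) - field_comb Y u (c u t).
pose dD t := inc h t - \sum_j h 0 j *: (s^-1 *: inc (s *: delta_mx 0 j) t).
have [z1 z2] : 0 <= (0 : R) <= 1 /\ 0 <= (1 : R) <= 1.
  by rewrite !lexx ler01.
have n1 : 0 < N.+1%:R :> R by [].
have e10 : 0 < e1 by rewrite divr_gt0// mulr_gt0.
have := @small_gronwall _ _ D dD (K * `|u|) (N.+1%:R * (e1 / 2) * `|h|)
   (small ur) _ _ _ _ 1 z2.
have -> : 2 * (N.+1%:R * (e1 / 2) * `|h|) = eta / 2 * `|h|.
  by rewrite /e1; field; rewrite nat1r pnatr_eq0.
move=> H; apply: le_trans (H _ _ _ _) _.
- by rewrite !mulr_ge0// ltW// divr_gt0.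
- rewrite /D !(rf_start F) ?uhr// subrr sub0r big1 ?oppr0// => j _.
  by rewrite (rf_start F) ?uhr// subrr !scaler0.
- move=> t t01.
  have dinc w : `|w| < d ->
      is_derive t (1 : R) (fun t => c (u + w) t - c u t) (inc w t).
    by move=> wd; apply: is_deriveB; apply: (rf_ode F) => //; exact: uhr.
  have -> : D = (fun t => c (u + h) t - c u t) -
      (\sum_(j < N) (h 0 j \*: (s^-1 \*:
        (fun t => c (u + s *: delta_mx 0 j) t - c u t)))).
    by apply/funext => t'; rewrite /D !fctE /= fct_sumE.
  apply: is_deriveB; first exact: dinc.
  apply: is_derive_sum => j; apply: is_deriveZ; apply: is_deriveZ.
  exact: dinc.
- move=> t t01.
  pose M := 'd (field_comb Y u) (c u t).
  have incE w : inc w t = M (c (u + w) t - c u t) + field_comb Y w (c u t)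
      + E w t by rewrite /E /inc subrKC.
  (* The linear parts recombine: [M] passes through the sum and the quotients of the fields add up
     to [field_comb Y h], which cancels. Only the errors remain. *)
  have -> : dD t = M (D t) + (E h t - \sum_j h 0 j *:
      (s^-1 *: E (s *: delta_mx 0 j) t)).
    rewrite /dD /D linearB (linear_sum M) incE.
    have -> : field_comb Y h (c u t) = \sum_j h 0 j *:
        (s^-1 *: field_comb Y (s *: delta_mx 0 j) (c u t)).
      apply: eq_bigr => j _.
      rewrite field_combZ [s^-1 *: _]scalerA mulVf// scale1r.
      congr (_ *: _); rewrite /field_comb (bigD1 j)//= big1 ?addr0.
        by rewrite mxE !eqxx scale1r.
      by move=> i /negPf ij; rewrite mxE ij andbF scale0r.
    have -> : \sum_j h 0 j *: (s^-1 *: inc (s *: delta_mx 0 j) t) =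
        \sum_j M (h 0 j *: (s^-1 *: (c (u + s *: delta_mx 0 j) t - c u t))) +
        \sum_j h 0 j *: (s^-1 *: field_comb Y (s *: delta_mx 0 j) (c u t)) +
        \sum_j h 0 j *: (s^-1 *: E (s *: delta_mx 0 j) t).
      rewrite -!big_split; apply: eq_bigr => j _ /=.
      by rewrite incE !(linearZ_LR M) -!scalerDr.
    set a := M _; set b := \sum_j _; set b' := \sum_j _; set b2 := \sum_j _.
    by apply/rowP => i; rewrite !mxE; ring.
  rewrite (le_trans (ler_normD _ _))// lerD//.
    have cu := rf_in F ur t01; have [du _] := Yd u cu.
    pose d2 := r - `|c u t - y0|.
    have d20 : 0 < d2 by rewrite subr_gt0.
    have [Ku0 _] := andP (small ur).
    apply: (diff_lipschitz_le du Ku0 d20) => w wd.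
    have cw : `|c u t + w - y0| < r.
      by rewrite addrAC (le_lt_trans (ler_normD _ _))// -ltrBrDl.
    have := rf_lip F u cw cu.
    by rewrite [_ + w - c u t]addrAC subrr add0r.
  rewrite (le_trans (ler_normB _ _))//.
  have Ej j : `|s^-1 *: E (s *: delta_mx 0 j) t| <= e1 / 2.
    rewrite normrZ normfV mulrC ler_pdivrMr//.
    by have := EP _ _ (sjd j) t01; rewrite normrZ norm_delta_row mulr1.
  rewrite (le_trans (lerD (EP _ _ hd t01) (norm_sum_rowZ h Ej)))//.
  by rewrite -mulrDl ler_wpM2r// -[X in X + _]mul1r -mulrDl nat1r.
- by rewrite ler_wpM2r//; lra.
Qed.

End Theory.
End RayFlow.

(** * Taylor expansion of the exponential map *)

Section WordPolynomials.
Context {R : realType} {N q : nat}.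
Implicit Types (P : seq ('rV[R]_q * seq 'I_N)) (u v : 'rV[R]_N).

Definition word_monomial (J : seq 'I_N) u : R := \prod_(j <- J) u 0 j.

(* Polynomial map with vector coefficients, given as a list of terms: the term
   [(a, [:: j1; ...; jk])] stands for [u_j1 ... u_jk a]. *)
Definition weval P u : 'rV[R]_q := \sum_(aJ <- P) word_monomial aJ.2 u *: aJ.1.

Lemma word_monomialZ (t : R) J u :
  word_monomial J (t *: u) = t ^+ size J * word_monomial J u.
Proof.
rewrite /word_monomial; elim: J => [|j J IH]; first by rewrite !big_nil mul1r.
by rewrite !big_cons IH mxE exprS mulrACA.
Qed.

Lemma weval_cons a J P u :
  weval ((a, J) :: P) u = word_monomial J u *: a + weval P u.
Proof. by rewrite /weval big_cons. Qed.

(* The polynomial [Q] with [Q 0 = a0] and [Q'(u) u = \sum_j u_j Ps_j(u)]. *)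
Definition ray_primitive a0 (Ps : 'I_N -> seq ('rV[R]_q * seq 'I_N)) :=
  (a0, [::]) :: flatten [seq [seq ((size aJ.2).+1%:R^-1 *: aJ.1, j :: aJ.2)
    | aJ <- Ps j] | j <- enum 'I_N].

Lemma weval_ray_primitive a0 Ps (t : R) u :
  weval (ray_primitive a0 Ps) (t *: u) = a0 + \sum_j \sum_(aJ <- Ps j)
    ((size aJ.2).+1%:R^-1 * t ^+ (size aJ.2).+1) *:
      (u 0 j *: (word_monomial aJ.2 u *: aJ.1)).
Proof.
rewrite weval_cons {1}/word_monomial big_nil scale1r; congr (_ + _).
rewrite /weval big_flatten /= big_map big_enum /=.
apply: eq_bigr => j _; rewrite big_map; apply: eq_bigr => -[a J] _ /=.
rewrite word_monomialZ /= {1}/word_monomial big_cons !scalerA; congr (_ *: _).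
by rewrite -/(word_monomial J u); ring.
Qed.

Lemma is_derive_sum_seq (V W : normedModType R) I (r : seq I) (f : I -> V -> W)
    (df : I -> W) (x v : V) : (forall i, is_derive x v (f i) (df i)) ->
  is_derive x v (fun y => \sum_(i <- r) f i y) (\sum_(i <- r) df i).
Proof.
move=> fdf; elim: r => [|i r IH].
  rewrite big_nil; have -> : (fun y => \sum_(i <- [::]) f i y) = cst 0.
    by apply/funext => y; rewrite big_nil.
  exact: is_derive_cst.
rewrite big_cons.
have -> : (fun y => \sum_(j <- i :: r) f j y) =
    f i + (fun y => \sum_(j <- r) f j y).
  by apply/funext => y; rewrite big_cons.
exact: is_deriveD.
Qed.

Lemma is_derive_monomial (W : normedModType R) n (w : W) (t : R) :
  is_derive t (1 : R) (fun s : R => (n.+1%:R^-1 * s ^+ n.+1) *: w)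
    (t ^+ n *: w).
Proof.
have dX := is_deriveX n.+1 (is_derive_id t (1 : R)).
have dnX : is_derive t (1 : R) (n.+1%:R^-1 \*: (@id R ^+ n.+1)) (t ^+ n).
  have := is_deriveZ (n.+1%:R^-1) dX => /is_derive_eq; apply.
  rewrite /GRing.scale /= mulr1 mulrA mulVf ?mul1r//.
have [ds dsE] := is_diff_scalel ((n.+1%:R^-1 \*: (@id R ^+ n.+1)) t) w.
have := is_derive_curve_comp dnX ds.
have -> : *:%R^~ w \o (n.+1%:R^-1 \*: (@id R ^+ n.+1)) =
    (fun s : R => (n.+1%:R^-1 * s ^+ n.+1) *: w).
  by apply/funext => s; rewrite /= fctE.
by move=> /is_derive_eq; apply; exact: (congr1 (@^~ (t ^+ n)) dsE).
Qed.

Lemma is_derive_ray_primitive a0 Ps u (t : R) :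
  is_derive t (1 : R) (fun s : R => weval (ray_primitive a0 Ps) (s *: u))
    (\sum_j u 0 j *: weval (Ps j) (t *: u)).
Proof.
have -> : (fun s : R => weval (ray_primitive a0 Ps) (s *: u)) = cst a0 +
    (fun s : R => \sum_j \sum_(aJ <- Ps j)
    ((size aJ.2).+1%:R^-1 * s ^+ (size aJ.2).+1) *:
      (u 0 j *: (word_monomial aJ.2 u *: aJ.1))).
  by apply/funext => s; rewrite weval_ray_primitive.
have -> : \sum_j u 0 j *: weval (Ps j) (t *: u) = 0 + \sum_j \sum_(aJ <- Ps j)
    t ^+ size aJ.2 *: (u 0 j *: (word_monomial aJ.2 u *: aJ.1)).
  rewrite add0r; apply: eq_bigr => j _; rewrite scaler_sumr.
  apply: eq_bigr => -[a J] _ /=; rewrite word_monomialZ !scalerA.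
  by congr (_ *: _); ring.
apply: is_deriveD; apply: is_derive_sum_seq => j; apply: is_derive_sum_seq.
by move=> aJ; exact: is_derive_monomial.
Qed.

Lemma weval_ray_primitive0 a0 Ps : weval (ray_primitive a0 Ps) 0 = a0.
Proof.
have := weval_ray_primitive a0 Ps 0 0; rewrite scale0r => ->.
rewrite big1 ?addr0// => j _; rewrite big1// => aJ _.
by rewrite exprS mul0r mulr0 scale0r.
Qed.

(* [P] is a Taylor polynomial of [f] of degree [d + 1]; bounding the Lipschitz
   constant of the remainder controls it together with its derivative. *)
Definition lip_jet d (f : 'rV[R]_N -> 'rV[R]_q) P : Prop :=
  f 0 = weval P 0 /\
  forall eta : R, 0 < eta -> exists2 delta, 0 < delta &
    forall (s : R) u v, s < delta -> `|u| <= s -> `|v| <= s ->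
    `|(f u - weval P u) - (f v - weval P v)| <= eta * s ^+ d * `|u - v|.

End WordPolynomials.

Lemma finite_pos_lower_bound {R : realType} n (d : 'I_n -> R) :
  (forall j, 0 < d j) -> exists2 e, 0 < e & forall j, e <= d j.
Proof.
move=> d0; exists (\big[Num.min/1]_j d j).
  exact: lt_bigmin.
by move=> j; by apply/bigmin_leP; right; exists j.
Qed.

Section FlowJets.
Context {R : realType} {N q : nat}.
Context {Y : 'I_N -> 'rV[R]_N -> 'rV[R]_N} {y0 : 'rV[R]_N} {r r0 B K : R}
  {c : 'rV[R]_N -> R -> 'rV[R]_N} (F : ray_flow Y y0 r r0 B K c).
Implicit Types g : 'rV[R]_N -> 'rV[R]_q.

Lemma flow_at0 : c 0 1 = y0.
Proof.
have z0 : `|0 : 'rV[R]_N| < r0 by rewrite normr0 (rf_r0 F).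
by rewrite -{1}(scale0r (0 : 'rV_N)) -(rf_ray F z0) ?lexx ?ler01// (rf_start F).
Qed.

(** Composition of strict differentiability of [g] at [y0] with that of the flow at 0. Half of [eta]
    goes to [g], where the flow contributes the factor [2 * B], and half to the nonlinear part of
    the flow, which is small because its rate is linear in [s]. *)
Lemma lip_jet_base g : differentiable g y0 -> strict_diff g y0 ('d g y0) ->
  exists P, lip_jet 0 (fun u => g (c u 1)) P.
Proof.
move=> dg sg.
have B0 := rf_B F; have r00 := rf_r0 F.
pose A := 'd g y0.
exists ((g y0, [::]) :: [seq (A (Y j y0), [:: j]) | j <- enum 'I_N]).
have PE u :
    weval ((g y0, [::]) :: [seq (A (Y j y0), [:: j]) | j <- enum 'I_N]) u
    = g y0 + A (field_comb Y u y0).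
  rewrite weval_cons {1}/word_monomial big_nil scale1r; congr (_ + _).
  rewrite /weval big_map big_enum /= (linear_sum A).
  apply: eq_bigr => j _.
  by rewrite (linearZ_LR A) /word_monomial big_cons big_nil mulr1.
split.
  rewrite PE flow_at0 -(scale0r (0 : 'rV_N)) field_combZ scale0r linear0.
  by rewrite addr0.
move=> eta eta0.
have [C [C0 CP]] := flow_strict_diff0 F.
have [KA KA0 KAP] := linear_row_bounded A.
have e1 : 0 < eta / (4 * B) by rewrite divr_gt0 ?mulr_gt0.
have [d d0 dP] := sg _ e1.
have C1 : 0 < C + 1 by rewrite ltr_wpDl.
pose delta := Num.min r0 (Num.min (d / (2 * B)) (eta / (2 * KA * (C + 1)))).
exists delta; first by rewrite !lt_min r00 !divr_gt0 ?mulr_gt0.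
move=> s u v; rewrite !lt_min => /and3P[sr s1 s2] us vs.
have [ur vr] : `|u| < r0 /\ `|v| < r0 by split; exact: le_lt_trans sr.
have z1 : 0 <= (1 : R) <= 1 by rewrite ler01 lexx.
have near_y0 w : `|w| <= s -> `|c w 1 - y0| < d.
  move=> ws; have wr : `|w| < r0 by exact: le_lt_trans sr.
  rewrite (le_lt_trans (flow_dist F wr z1))// mulrC -ltr_pdivlMr ?mulr_gt0//.
  exact: le_lt_trans s1.
rewrite !PE expr0 mulr1.
have -> : g (c u 1) - (g y0 + A (field_comb Y u y0)) -
    (g (c v 1) - (g y0 + A (field_comb Y v y0))) =
    (g (c u 1) - g (c v 1) - A (c u 1 - c v 1)) +
    A ((c u 1 - 1 *: field_comb Y u y0) - (c v 1 - 1 *: field_comb Y v y0)).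
  rewrite !scale1r !linearB; apply/rowP => i; rewrite !mxE; ring.
have h1 := dP _ _ (near_y0 _ us) (near_y0 _ vs).
have h2 := flow_lipschitz F ur vr z1.
have h3 := CP s u v 1 us vs sr z1.
rewrite (le_trans (ler_normD _ _))// [eta]splitr mulrDl lerD//.
  rewrite (le_trans h1)// (le_trans (ler_wpM2l (ltW e1) h2))//.
  rewrite le_eqVlt; apply/orP; left; apply/eqP; field.
  by rewrite gt_eqF.
rewrite (le_trans (KAP _))// (le_trans (ler_wpM2l (ltW KA0) h3))//.
rewrite !mulrA ler_wpM2r//.
have s0 : 0 <= s by exact: le_trans us.
move: s2; rewrite ltr_pdivlMr ?mulr_gt0// => s2.
nra.
Qed.

(** The time derivative of [g] along the curve is the combination of its Lie derivatives at the
    point with coordinates [t *: u], so integrating their jets gives a jet of [g]. In the difference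
    of two remainders each term gains a factor [s]: either the remainder of a Lie derivative, which
    vanishes at 0, is evaluated within distance [s], or its variation is multiplied by a coordinate
    of [v]. *)
Lemma lip_jet_step d g (P : 'I_N -> seq ('rV[R]_q * seq 'I_N)) :
  (forall y, `|y - y0| < r -> differentiable g y) ->
  (forall j, lip_jet d (fun u => 'd g (c u 1) (Y j (c u 1))) (P j)) ->
  lip_jet d.+1 (fun u => g (c u 1)) (ray_primitive (g y0) P).
Proof.
move=> dg jP; split; first by rewrite flow_at0 weval_ray_primitive0.
move=> eta eta0; have r00 := rf_r0 F.
pose eta1 := eta / (2 * N.+1%:R).
have eta10 : 0 < eta1 by rewrite divr_gt0 ?mulr_gt0.
pose rho j w := 'd g (c w 1) (Y j (c w 1)) - weval (P j) w.
have [dj djP] : exists dj : 'I_N -> R, forall j, 0 < dj j /\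
    forall (s : R) u v, s < dj j -> `|u| <= s -> `|v| <= s ->
    `|rho j u - rho j v| <= eta1 * s ^+ d * `|u - v|.
  suff /choice : forall j, exists e : R, 0 < e /\ forall (s : R) u v, s < e ->
    `|u| <= s -> `|v| <= s -> `|rho j u - rho j v| <= eta1 * s ^+ d * `|u - v|.
    by case=> f fP; exists f.
  by move=> j; have [e e0 eP] := (jP j).2 _ eta10; exists e.
have [e e0 eP] := finite_pos_lower_bound (fun j => (djP j).1).
have rho0 j : rho j 0 = 0 by rewrite /rho (jP j).1 subrr.
exists (Num.min r0 e); first by rewrite lt_min r00.
move=> s u v; rewrite lt_min => /andP[sr se] us vs.
have [ur vr] : `|u| < r0 /\ `|v| < r0 by split; exact: le_lt_trans sr.
have s0 : 0 <= s by exact: le_trans us.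
have rhoL j a b : `|a| <= s -> `|b| <= s ->
    `|rho j a - rho j b| <= eta1 * s ^+ d * `|a - b|.
  by move=> as_ bs; apply: (djP j).2 => //; exact: lt_le_trans (eP j).
set Q := ray_primitive (g y0) P.
pose D (t : R) := (g (c u t) - weval Q (t *: u)) -
                  (g (c v t) - weval Q (t *: v)).
pose dD (t : R) := \sum_j u 0 j *: rho j (t *: u) -
                   \sum_j v 0 j *: rho j (t *: v).
have D1E w : `|w| < r0 -> forall t : R, 0 <= t <= 1 ->
    is_derive t (1 : R) (fun t => g (c w t) - weval Q (t *: w))
      (\sum_j w 0 j *: rho j (t *: w)).
  move=> wr t t01.
  have dgc := dg _ (rf_in F wr t01).
  have := is_deriveB (is_derive_curve_comp (rf_ode F wr t01) dgc)
    (is_derive_ray_primitive (g y0) P w t).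
  move=> /is_derive_eq; apply.
  rewrite /field_comb (linear_sum ('d g (c w t))) -sumrB.
  apply: eq_bigr => j _; rewrite (linearZ_LR ('d g (c w t))) -scalerBr.
  by rewrite /rho -(rf_ray F wr t01).
have z1 : 0 <= (1 : R) <= 1 by rewrite ler01 lexx.
have D0 : D 0 = 0.
  by rewrite /D !scale0r !(rf_start F)// weval_ray_primitive0 !subrr.
have E0 : 0 <= eta * s ^+ d.+1 * `|u - v|.
  by rewrite !mulr_ge0 ?exprn_ge0 ?(ltW eta0).
have DdD (t : R) : 0 <= t <= 1 -> is_derive t (1 : R) D (dD t).
  by move=> t01; apply: is_deriveB; exact: D1E.
suff dDb (t : R) : 0 <= t <= 1 -> `|dD t| <= eta * s ^+ d.+1 * `|u - v|.
  have := curve_mvt ler01 E0 DdD dDb.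
  by rewrite D0 subr0 /D !scale1r [leRHS]mulr1.
move=> /andP[t0 t1].
have ts (w : 'rV[R]_N) : `|w| <= s -> `|t *: w| <= s.
  by move=> ws; rewrite normrZ ger0_norm// (le_trans _ ws)// ler_piMl.
have -> : dD t = \sum_j (u - v) 0 j *: rho j (t *: u) +
    \sum_j v 0 j *: (rho j (t *: u) - rho j (t *: v)).
  rewrite /dD -big_split -sumrB; apply: eq_bigr => j _ /=.
  by apply/rowP => i; rewrite !mxE; ring.
have b1 j : `|rho j (t *: u)| <= eta1 * s ^+ d.+1.
  rewrite -[rho _ _]subr0 -(rho0 j).
  have z0 : `|0 : 'rV[R]_N| <= s by rewrite normr0.
  rewrite (le_trans (rhoL j (t *: u) 0 (ts _ us) z0))// subr0 exprSr mulrA.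
  apply: ler_wpM2l; last exact: ts.
  by rewrite mulr_ge0 ?exprn_ge0 ?(ltW eta10).
have b2 j : `|rho j (t *: u) - rho j (t *: v)| <= eta1 * s ^+ d * `|u - v|.
  rewrite (le_trans (rhoL j _ _ (ts _ us) (ts _ vs)))// ler_wpM2l//.
    by rewrite mulr_ge0 ?exprn_ge0 ?(ltW eta10).
  by rewrite -scalerBr normrZ ger0_norm// ler_piMl.
rewrite (le_trans (ler_normD _ _))//.
rewrite (le_trans (lerD (norm_sum_rowZ (u - v) b1) (norm_sum_rowZ v b2)))//.
have sd0 : 0 <= s ^+ d by rewrite exprn_ge0.
have e2 : N%:R * (eta1 * s ^+ d * `|u - v|) * `|v| <=
    N%:R * (eta1 * s ^+ d * `|u - v|) * s.
  by rewrite ler_wpM2l// !mulr_ge0// ltW.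
rewrite (le_trans (lerD (lexx _) e2))//.
have -> : N%:R * (eta1 * s ^+ d.+1) * `|u - v| +
    N%:R * (eta1 * s ^+ d * `|u - v|) * s =
    2 * N%:R * eta1 * (s ^+ d.+1 * `|u - v|) by rewrite exprS; ring.
rewrite -[leRHS]mulrA ler_wpM2r ?mulr_ge0 ?exprn_ge0//.
rewrite /eta1 mulrA ler_pdivrMr ?mulr_gt0// mulrC ler_wpM2l ?(ltW eta0)//.
by rewrite ler_wpM2l// ler_nat.
Qed.

(** Induction on [d] with [g] varying: each Lie derivative consumes one order of smoothness of [g],
    and what is left at the end is C^1, as the base case requires. *)
Lemma lip_jet_flow d (A : set 'rV[R]_N) g : open A ->
  (forall y, `|y - y0| < r -> A y) -> (forall j, Ck d A (Y j)) ->
  Ck d.+1 A g -> exists P, lip_jet d (fun u => g (c u 1)) P.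
Proof.
move=> oA rA; have r_gt0 : 0 < r.
  have z0 : `|0 : 'rV[R]_N| < r0 by rewrite normr0 (rf_r0 F).
  have := rf_in F z0 (t := 0); rewrite lexx ler01 => /(_ isT).
  exact: le_lt_trans.
have Ay0 : A y0 by apply: rA; rewrite subrr normr0.
elim: d g => [|d IH] g YA gA.
  have [dg _] := gA.
  exact: (lip_jet_base (dg _ Ay0) (C1_strict oA Ay0 gA)).
have [P PP] : exists P : 'I_N -> seq ('rV[R]_q * seq 'I_N), forall j,
    lip_jet d (fun u => 'd g (c u 1) (Y j (c u 1))) (P j).
  suff /choice : forall j, exists P,
      lip_jet d (fun u => 'd g (c u 1) (Y j (c u 1))) P.
    by case=> f fP; exists f.
  move=> j.
  apply: (IH (fun y => 'd g y (Y j y))) => [i|]; first exact: CkW.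
  exact: Ck_lie.
have [dg _] := gA.
by exists (ray_primitive (g y0) P); apply: lip_jet_step => // y /rA; exact: dg.
Qed.

End FlowJets.

(** * Integral curves on the manifold *)

(** Continuity method: let [b] be the last time up to which the curve stays in [K]. Closedness
    includes [b], openness of [O] carries the curve a little further, and the implication from [O]
    to [K] contradicts maximality if [b < 1]. *)
Lemma interval_bootstrap {R : realType} (T : topologicalType) (g : R -> T)
    (O K : set T) : open O -> closed K -> K `<=` O -> K (g 0) ->
  (forall t : R, 0 <= t <= 1 -> {for t, continuous g}) ->
  (forall t : R, 0 <= t <= 1 -> (forall s, 0 <= s <= t -> O (g s)) ->
     K (g t)) ->
  forall t : R, 0 <= t <= 1 -> K (g t).
Proof.
move=> oO cK KO K0 gc OK.
pose S := [set t : R | 0 <= t <= 1 /\ forall s, 0 <= s <= t -> K (g s)].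
have S0 : S 0.
  split=> [|s]; first by rewrite lexx ler01.
  by move=> /le_anti <-.
have Sub : has_ubound S by exists 1 => t [/andP[]].
have hS : has_sup S by split; [exists 0|].
set b := sup S.
have b0 : 0 <= b by exact: sup_upper_bound hS _ S0.
have b1 : b <= 1 by apply: ge_sup; [exists 0|move=> t [/andP[]]].
have b01 : 0 <= b <= 1 by rewrite b0.
have Kb s : 0 <= s < b -> K (g s).
  move=> /andP[s0 sb]; have bs : 0 < b - s by rewrite subr_gt0.
  have [t [t01 tK] bt] := sup_adherent bs hS.
  by apply: tK; rewrite s0 ltW// (le_lt_trans _ bt)// -/b; lra.
have Kgb : K (g b).
  have [b_gt0|] := ltP 0 b; last first.
    by move=> b00; have -> : b = 0 by apply/le_anti; rewrite b00.
  rewrite (closure_id K).1// => V nV.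
  have := gc b b01 V nV => /nbhs_ballP[e /= e0 eV].
  pose s := Num.max 0 (b - e / 2).
  have sb : s < b by rewrite gt_max b_gt0 /=; lra.
  have s0 : 0 <= s by rewrite le_max lexx.
  exists (g s); split; first by apply: Kb; rewrite s0.
  apply: eV; rewrite -ball_normE /= ger0_norm ?subr_ge0 ?ltW//.
  have : b - e / 2 <= s by rewrite le_max lexx orbT.
  lra.
have Sb : S b.
  split=> // s /andP[s0]; rewrite le_eqVlt => /predU1P[->//|sb].
  by apply: Kb; rewrite s0.
have nO : \forall t \near b, O (g t).
  apply: (gc b b01); apply: open_nbhs_nbhs; split=> //; exact: KO.
have b_eq1 : b = 1.
  apply/le_anti; rewrite b1 /= leNgt; apply/negP => b_lt1.
  have [e /= e0 eO] := (nbhs_ballP _ _).1 nO.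
  pose t := Num.min 1 (b + e / 2).
  have bt : b < t by rewrite lt_min b_lt1 /=; lra.
  have t1 : t <= 1 by rewrite ge_min lexx.
  have te : t <= b + e / 2 by rewrite ge_min lexx orbT.
  have Ot s : 0 <= s <= t -> O (g s).
    move=> /andP[s0 st]; have [sb|bs] := leP s b.
      by apply: KO; have [_] := Sb; apply; rewrite s0.
    by apply: eO; rewrite -ball_normE /= ltr0_norm; lra.
  have : S t.
    split=> [|s /andP[s0 st]]; first by rewrite t1 (le_trans b0)// ltW.
    apply: OK; first by rewrite s0 (le_trans st).
    by move=> s' /andP[s'0 s's]; apply: Ot; rewrite s'0 (le_trans s's).
  by move=> /(sup_upper_bound hS); rewrite leNgt bt.
move=> t t01; have [_] := Sb; apply.
by rewrite b_eq1.
Qed.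

Lemma chart_image_open {R : realType} {N : nat} (T : topologicalType)
    (c : chart R N T) (W : set T) :
  open W -> open (cmap c @` (W `&` csrc c)).
Proof.
move=> oW; rewrite openE => _ [x [Wx cx] <-].
have cy := cmap_in cx.
have n1 : nbhs (cmap c x) (ctgt c).
  by apply: open_nbhs_nbhs; split => //; exact: ctgt_open.
have n2 : nbhs (cmap c x) (cinv c @^-1` W).
  apply: (cinv_cont cy); apply: open_nbhs_nbhs; split => //.
  by rewrite cmapK.
apply: filterS (@filterI _ (nbhs (cmap c x)) _ _ _ n1 n2) => y [ty Wy].
by exists (cinv c y); [split=> //; exact: cinv_in|exact: cinvK].
Qed.

Section Velocity.
Context {R : realType} {N : nat} {M : smooth_manifold R N}.

Lemma tcoord_sum (c : chart R N M) (x : M) (u : 'rV[R]_N)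
    (v : 'I_N -> 'rV[R]_N) :
  tcoord c x (\sum_j u 0 j *: v j) = \sum_j u 0 j *: tcoord c x (v j).
Proof.
rewrite /tcoord; set A := 'd _ _; rewrite (linear_sum A).
by apply: eq_bigr => j _; rewrite (linearZ_LR A).
Qed.

(** [is_velocity] refers to the preferred chart at [g t], which changes along the curve; the chain
    rule for the transition map moves the velocity to one fixed chart. *)
Lemma velocity_in_chart (c : chart R N M) (g : R -> M) (t : R) v :
  atlas c -> csrc c (g t) -> is_velocity g t v ->
  is_derive t (1 : R) (cmap c \o g) (tcoord c (g t) v).
Proof.
move=> ac cgt [gc gv]; pose d := chart_at (g t).
have dgt : csrc d (g t) by exact: chart_at_src.
have ad : atlas d by exact: chart_at_atlas.
have [dcd _] := (atlas_compatible ac ad 1).2.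
have /dcd dphi : (cmap d @` (csrc c `&` csrc d)) (cmap d (g t)).
  by exists (g t).
have := is_derive_curve_comp gv dphi.
apply: near_eq_is_derive.
have nd : \forall s \near t, csrc d (g s).
  by apply: gc; apply: open_nbhs_nbhs; split => //; exact: csrc_open.
by apply: filterS nd => s ds /=; rewrite cmapK.
Qed.

End Velocity.

Lemma is_derive_scaled_time {R : realType} (W : normedModType R) (f : R -> W)
    (a t : R) w : is_derive (a * t) (1 : R) f w ->
  is_derive t (1 : R) (fun s => f (a * s)) (a *: w).
Proof.
move=> fw; have df : differentiable f (a * t).
  by apply/derivable1_diffP; exact: ex_derive.
have da : is_derive t (1 : R) ( *%R a) a.
  have := is_deriveZ a (is_derive_id t (1 : R)).
  by move=> /is_derive_eq; apply; rewrite /GRing.scale /= mulr1.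
have := is_derive_curve_comp da df; move=> /is_derive_eq; apply.
rewrite -[X in 'd f _ X]mulr1 (linearZ_LR ('d f (a * t)) a 1) -deriveE//.
by congr (_ *: _); exact: derive_val.
Qed.

Section ExpFlow.
Context {R : realType} {N : nat} {M : smooth_manifold R N}.

(** A compact subset of a Hausdorff space is closed. This prevents a curve from leaving the chart
    through a limit point outside its source. *)
Lemma closed_chart_ball (c : chart R N M) y0 (r : R) : 0 < r ->
  (forall y, `|y - y0| <= r -> ctgt c y) ->
  closed (cinv c @` [set y | `|y - y0| <= r]).
Proof.
move=> r0 rc; apply: (compact_closed (@manifold_hausdorff R N M)).
have -> : [set y | `|y - y0| <= r] = closed_ball y0 r.
  by rewrite closed_ballE//; apply/seteqP; split=> y /=;
    rewrite /closed_ball_ /= distrC.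
apply: continuous_compact.
  apply: continuous_in_subspaceT => y; rewrite inE closed_ballE//.
  by rewrite /closed_ball_ /= distrC => /rc; exact: cinv_cont.
apply: bounded_closed_compact; last exact: closed_ball_closed.
exists (`|y0| + r); split; first exact: num_real.
move=> b bM y; rewrite closed_ballE// /closed_ball_ /= => yr.
have := ler_normB y0 (y0 - y); rewrite subKr.
lra.
Qed.

Context (U : set M) (X : 'I_N -> M -> 'rV[R]_N) (p : M)
  (theta : 'rV[R]_N -> M).

(** The curves given by [is_exp] are chosen independently for each [u] and may a priori leave the
    chart at [p]. They are confined by a bootstrap argument, and the ray identity relating them
    follows from uniqueness. The bound [rmax] lets the caller place the whole flow in a given
    neighbourhood. *)
Lemma exp_ray_flow (rmax : R) (c := chart_at p) (Y := fun j => vf_in c (X j)) :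
  open U -> U p -> (forall j, Ck_vector_field 1 U (X j)) ->
  nbhs (0 : 'rV[R]_N) [set u : 'rV[R]_N |
    is_exp U (fun x => \sum_(j < N) u 0 j *: X j x) p (theta u)] ->
  0 < rmax ->
  exists r r0 B K g, [/\ 0 < r <= rmax, ray_flow Y (cmap c p) r r0 B K g,
    forall y, `|y - cmap c p| < r -> (cmap c @` (U `&` csrc c)) y &
    forall u, `|u| < r0 -> csrc c (theta u) /\ g u 1 = cmap c (theta u)].
Proof.
move=> oU Up XC1 thetaP rmax0; set y0 := cmap c p.
have ac : atlas c by exact: chart_at_atlas.
have cp : csrc c p by exact: chart_at_src.
pose A := cmap c @` (U `&` csrc c).
have oA : open A by exact: chart_image_open.
have Ay0 : A y0 by exists p.
have YC1 j : Ck 1 A (Y j) by exact: XC1.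
have [Kd KdP] : exists Kd : 'I_N -> R * R, forall j,
    [/\ 0 < (Kd j).1, 0 < (Kd j).2 & forall y z, `|y - y0| < (Kd j).2 ->
      `|z - y0| < (Kd j).2 -> `|Y j y - Y j z| <= (Kd j).1 * `|y - z|].
  suff /choice : forall j, exists Kd : R * R, [/\ 0 < Kd.1, 0 < Kd.2 &
      forall y z, `|y - y0| < Kd.2 -> `|z - y0| < Kd.2 ->
      `|Y j y - Y j z| <= Kd.1 * `|y - z|].
    by case=> f fP; exists f.
  move=> j; have := C1_strict oA Ay0 (YC1 j).
  by move=> /strict_diff_lipschitz[K [d KdP]]; exists (K, d).
have [d1 d10 d1P] : exists2 d1, 0 < d1 & forall j, d1 <= (Kd j).2.
  by apply: finite_pos_lower_bound => j; have [] := KdP j.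
have [d2 /= d20 d2A] := (nbhs_ballP _ _).1 (open_nbhs_nbhs (conj oA Ay0)).
have [e0 /= e00 e0P] := (nbhs_ballP _ _).1 thetaP.
pose r := Num.min rmax (Num.min d1 d2).
have r_gt0 : 0 < r by rewrite !lt_min rmax0 d10.
have r_max : r <= rmax by rewrite ge_min lexx.
have rd1 : r <= d1 by rewrite !ge_min lexx orbT.
have rA y : `|y - y0| < r -> A y.
  move=> yr; apply: d2A; rewrite -ball_normE /= distrC (lt_le_trans yr)//.
  by rewrite !ge_min lexx !orbT.
have rc y : `|y - y0| < r -> ctgt c y.
  by move=> /rA[x [_ cx] <-]; exact: cmap_in.
pose SK := \sum_j (Kd j).1; pose SY := \sum_j `|Y j y0|.
have Kd0 j : 0 <= (Kd j).1 by have [/ltW] := KdP j.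
have SK0 : 0 <= SK by exact: sumr_ge0.
have SY0 : 0 <= SY by exact: sumr_ge0.
pose K := N%:R * SK + 1; pose B := N%:R * (SK * r + SY) + 1.
have K0 : 0 < K by rewrite ltr_wpDl// mulr_ge0.
have B0 : 0 < B by rewrite ltr_wpDl// mulr_ge0// addr_ge0// mulr_ge0// ltW.
have Yl j y z : `|y - y0| < r -> `|z - y0| < r ->
    `|Y j y - Y j z| <= SK * `|y - z|.
  move=> yr zr; have [_ _ H] := KdP j.
  apply: (le_trans (H _ _ _ _)).
  - exact: (lt_le_trans yr (le_trans rd1 (d1P j))).
  - exact: (lt_le_trans zr (le_trans rd1 (d1P j))).
  rewrite ler_wpM2r// /SK (bigD1 j)//= lerDl sumr_ge0//.
have y0r : `|y0 - y0| < r by rewrite subrr normr0.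
have Yb j y : `|y - y0| < r -> `|Y j y| <= SK * r + SY.
  move=> yr; rewrite -(subrK (Y j y0) (Y j y)) (le_trans (ler_normD _ _))//.
  rewrite lerD//.
    by rewrite (le_trans (Yl _ _ _ yr y0r))// ler_wpM2l// ltW.
  by rewrite /SY (bigD1 j)//= lerDl sumr_ge0.
have Wl u y z : `|y - y0| < r -> `|z - y0| < r ->
    `|field_comb Y u y - field_comb Y u z| <= K * `|u| * `|y - z|.
  move=> yr zr; rewrite /field_comb -sumrB.
  under eq_bigr do rewrite -scalerBr.
  rewrite (le_trans (norm_sum_rowZ u (fun j => Yl j y z yr zr)))//.
  rewrite mulrA mulrAC ler_wpM2r// ler_wpM2r// /K; lra.
have Wb u y : `|y - y0| < r -> `|field_comb Y u y| <= B * `|u|.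
  move=> yr; rewrite (le_trans (norm_sum_rowZ u (fun j => Yb j y yr)))//.
  by rewrite ler_wpM2r// /B; lra.
(* The second bound keeps the speed below [r / 4], so that unit time does not suffice to leave the
   ball of radius [r / 2]; the third one meets the smallness condition of Gronwall. *)
pose r0 := Num.min e0 (Num.min (r / (4 * B)) (2 * K)^-1).
have r00 : 0 < r0 by rewrite !lt_min e00 divr_gt0 ?invr_gt0 ?mulr_gt0.
have r0e : r0 <= e0 by rewrite ge_min lexx.
have r0B : r0 <= r / (4 * B) by rewrite !ge_min lexx orbT.
have r0K : r0 <= (2 * K)^-1 by rewrite !ge_min lexx !orbT.
have [g gP] : exists g : 'rV[R]_N -> R -> M, forall u, `|u| < r0 ->
    [/\ g u 0 = p, g u 1 = theta u & forall t : R, 0 <= t <= 1 -> U (g u t) /\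
      is_velocity (g u) t (\sum_(j < N) u 0 j *: X j (g u t))].
  suff /choice : forall u : 'rV[R]_N, exists g : R -> M, `|u| < r0 ->
      [/\ g 0 = p, g 1 = theta u & forall t : R, 0 <= t <= 1 -> U (g t) /\
      is_velocity g t (\sum_(j < N) u 0 j *: X j (g t))].
    by case=> f fP; exists f.
  move=> u; have [ur|] := boolP (`|u| < r0); last by exists (fun=> p).
  have [g gP] : is_exp U (fun x => \sum_(j < N) u 0 j *: X j x) p (theta u).
    by apply: e0P; rewrite -ball_normE /= sub0r normrN (lt_le_trans ur).
  by exists g.
have gder u t : `|u| < r0 -> 0 <= t <= 1 -> csrc c (g u t) ->
    is_derive t (1 : R) (cmap c \o g u) (field_comb Y u (cmap c (g u t))).
  move=> ur t01 cg; have [_ _ /(_ t t01)[_ gv]] := gP u ur.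
  have := velocity_in_chart ac cg gv; rewrite tcoord_sum.
  by rewrite /field_comb /Y /vf_in cmapK.
have r2 : 0 < r / 2 by rewrite divr_gt0.
have gin u t : `|u| < r0 -> 0 <= t <= 1 ->
    csrc c (g u t) /\ `|cmap c (g u t) - y0| <= r / 2.
  move=> ur t01; have [gu0 gu1 guP] := gP u ur.
  pose Kset := cinv c @` [set y | `|y - y0| <= r / 2].
  pose O := csrc c `&` (cmap c @^-1` [set y | `|y - y0| < r]).
  have rr y : `|y - y0| <= r / 2 -> `|y - y0| < r by move=> ?; lra.
  have oO : open O.
    rewrite openE => x [cx xr].
    have n1 : nbhs x (csrc c).
      by apply: open_nbhs_nbhs; split => //; exact: csrc_open.
    have n2 : nbhs x (cmap c @^-1` [set y | `|y - y0| < r]).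
      apply: (cmap_cont cx); apply/nbhs_ballP.
      exists (r - `|cmap c x - y0|); first by rewrite /= subr_gt0.
      move=> y; rewrite -ball_normE /= => yx.
      have -> : y - y0 = (cmap c x - y0) - (cmap c x - y).
        by apply/rowP => i; rewrite !mxE; ring.
      by rewrite (le_lt_trans (ler_normB _ _))//; lra.
    exact: (@filterI _ (nbhs x) _ _ _ n1 n2).
  have KO : Kset `<=` O.
    by move=> _ [y /= /rr yr <-]; split; [exact/cinv_in/rc|
      rewrite /= cinvK//; exact: rc].
  have cK : closed Kset.
    by apply: closed_chart_ball => // y /rr; exact: rc.
  (* As long as the curve stays in [O] the speed bound is valid, and it places the curve in the
     smaller closed ball. *)
  have [y yr gy] : Kset (g u t).
    apply: (interval_bootstrap oO cK KO) => //.
    - by rewrite gu0; exists y0; rewrite /= ?subrr ?normr0 ?(ltW r2)// cmapK.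
    - by move=> s s01; have [_ []] := guP s s01.
    move=> s s01 sO; have s001 : 0 <= s <= s.
      by rewrite lexx andbT; case/andP: s01.
    have [cgs _] := sO s s001.
    exists (cmap c (g u s)); last by rewrite cmapK.
    have [s0 s1] := andP s01.
    have := @curve_mvt _ _ (cmap c \o g u)
      (fun a => field_comb Y u (cmap c (g u a))) s (r / 2) s0 (ltW r2).
    rewrite /= gu0 => H; apply: le_trans (H _ _) _.
    - move=> a /andP[a0 as_]; apply: gder => //.
        by rewrite a0 (le_trans as_).
      by have [] := sO a; rewrite ?a0.
    - move=> a a0s; have [_ /= ar] := sO a a0s.
      rewrite (le_trans (Wb u _ ar))//.
      have : `|u| <= r / (4 * B) by rewrite (le_trans (ltW ur)).
      by rewrite ler_pdivlMr ?mulr_gt0//; lra.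
    - by rewrite ler_piMr// ltW.
  have yc := rc _ (rr _ yr).
  by rewrite -gy cinvK//; split=> //; exact: cinv_in.
exists r, r0, B, K, (fun u t => cmap c (g u t)).
have ode u (t : R) : `|u| < r0 -> 0 <= t <= 1 -> is_derive t (1 : R)
    (fun t => cmap c (g u t)) (field_comb Y u (cmap c (g u t))).
  by move=> ur t01; apply: gder => //; have [] := gin u t ur t01.
have inr u (t : R) : `|u| < r0 -> 0 <= t <= 1 -> `|cmap c (g u t) - y0| < r.
  by move=> ur t01; have [_] := gin u t ur t01; lra.
have z1 : 0 <= (1 : R) <= 1 by rewrite ler01 lexx.
split=> //; first by rewrite r_gt0.
  split=> //.
  - rewrite (le_trans (ler_wpM2l (ltW K0) r0K))// invfM mulrCA divff ?mulr1//.
    by rewrite gt_eqF.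
  - by move=> u ur; have [->] := gP u ur.
  move=> u t ur t01; have [t0 t1] := andP t01.
  have tur : `|t *: u| < r0.
    by rewrite (le_lt_trans _ ur)// normrZ ger0_norm// ler_piMl.
  have ts01 s : 0 <= s <= 1 -> 0 <= t * s <= 1.
    by move=> /andP[s0 s1]; rewrite mulr_ge0//= mulr_ile1.
  (* Both curves solve the equation with coefficients [t *: u] from the same point; Gronwall with
     zero forcing makes them equal. *)
  pose D (s : R) := cmap c (g u (t * s)) - cmap c (g (t *: u) s).
  pose dD (s : R) := t *: field_comb Y u (cmap c (g u (t * s))) -
    field_comb Y (t *: u) (cmap c (g (t *: u) s)).
  have K01 : 0 <= K * `|t *: u| <= 2^-1.
    rewrite mulr_ge0 ?(ltW K0)//= (le_trans (ler_wpM2l (ltW K0) (ltW tur)))//.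
    rewrite (le_trans (ler_wpM2l (ltW K0) r0K))// invfM mulrCA divff ?mulr1//.
    by rewrite gt_eqF.
  have D0 : D 0 = 0.
    rewrite /D mulr0; have [-> _ _] := gP u ur; have [-> _ _] := gP _ tur.
    by rewrite subrr.
  have DdD (s : R) : 0 <= s <= 1 -> is_derive s (1 : R) D (dD s).
    move=> s01; apply: is_deriveB; last exact: ode.
    by apply: (is_derive_scaled_time (f := fun t => cmap c (g u t)));
      apply: ode => //; exact: ts01.
  have dDb (s : R) : 0 <= s <= 1 -> `|dD s| <= K * `|t *: u| * `|D s| + 0.
    move=> s01; rewrite addr0 /dD -field_combZ.
    by apply: Wl; apply: inr => //; exact: ts01.
  have := small_gronwall K01 (lexx 0) D0 DdD dDb z1.
  by rewrite mulr0 normr_le0 subr_eq0 mulr1 => /eqP.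
move=> u ur; have [cg _] := gin u 1 ur z1; have [_ <- _] := gP u ur.
by split.
Qed.

End ExpFlow.

(** * Weighted homogeneous limits *)

Section LipschitzPerturbation.
Context {R : realType} {n : nat}.
Implicit Types (G : 'rV[R]_n -> 'rV[R]_n) (A : 'M[R]_n).

(** After applying the inverse of [A], the perturbation is at most half of [|x - y|] and is
    absorbed. The quantitative form also bounds the Lipschitz constant of the inverse map. *)
Lemma perturbation_injective G A (K c s : R) : A \in unitmx ->
  0 <= K -> K * c <= 2^-1 ->
  (forall v : 'rV[R]_n, `|v *m invmx A| <= K * `|v|) ->
  (forall x y, `|x| <= s -> `|y| <= s ->
     `|G x - G y - (x - y) *m A| <= c * `|x - y|) ->
  forall x y, `|x| <= s -> `|y| <= s -> `|x - y| <= 2 * K * `|G x - G y|.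
Proof.
move=> Au K0 Kc KA GA x y xs ys.
have E : x - y = (G x - G y) *m invmx A
    - (G x - G y - (x - y) *m A) *m invmx A.
  by rewrite -mulmxBl opprB subrKC mulmxK.
have h0 := KA (G x - G y).
have h1 := KA (G x - G y - (x - y) *m A).
have h2 := ler_wpM2l K0 (GA x y xs ys).
have h3 : `|x - y| <= K * `|G x - G y| + K * (c * `|x - y|).
  by rewrite {1}E (le_trans (ler_normB _ _))// lerD// (le_trans h1).
have := normr_ge0 (x - y); nra.
Qed.

(** Newton's iteration with the derivative frozen at [A]: the map [T] contracts by one half, and its
    value at 0 has norm at most [s / 2], so it preserves the ball of radius [s]. Its fixed point
    solves the equation. *)
Lemma perturbation_surjective G A (K c s : R) : A \in unitmx -> 0 <= s ->
  0 < K -> K * c <= 2^-1 ->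
  (forall v : 'rV[R]_n, `|v *m invmx A| <= K * `|v|) ->
  (forall x y, `|x| <= s -> `|y| <= s ->
     `|G x - G y - (x - y) *m A| <= c * `|x - y|) ->
  forall w, `|w - G 0| <= s / (2 * K) -> exists x, `|x| <= s /\ G x = w.
Proof.
move=> Au s0 K0 Kc KA GA w ws.
pose T x := x - (G x - w) *m invmx A.
pose S := [set x : 'rV[R]_n | `|x| <= s].
have half0 : (0 : R) <= 2^-1 by rewrite invr_ge0.
have TL x y : S x -> S y -> `|T x - T y| <= 2^-1 * `|x - y|.
  move=> xs ys.
  have -> : T x - T y = - ((G x - G y - (x - y) *m A) *m invmx A).
    rewrite mulmxBl mulmxK// /T opprB mulmxBl !mulmxBl.
    by apply/rowP => i; rewrite !mxE; ring.
  rewrite normrN (le_trans (KA _))//.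
  rewrite (le_trans (ler_wpM2l (ltW K0) (GA _ _ xs ys)))// mulrA ler_wpM2r//.
have TS : set_fun S S T.
  move=> x xs; have S0 : S 0 by rewrite /S /= normr0.
  have := TL _ _ xs S0; rewrite subr0 => h1.
  have T0 : `|T 0| <= s / 2.
    rewrite /T sub0r -mulNmx opprB (le_trans (KA _))//.
    rewrite (le_trans (ler_wpM2l (ltW K0) ws))//.
    by rewrite le_eqVlt; apply/orP; left; apply/eqP; field; rewrite gt_eqF.
  rewrite /S /= -(subrK (T 0) (T x)) (le_trans (ler_normD _ _))//.
  by have : `|x| <= s := xs; lra.
have cS : closed S.
  have -> : S = closed_ball_ (fun x : 'rV[R]_n => `|x|) 0 s.
    by apply/seteqP; split=> x; rewrite /S /closed_ball_ /= sub0r normrN.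
  exact: closed_closed_ball_.
have ctr : is_contraction (mkfun_fun TS).
  exists (NngNum half0); split=> /=; first by rewrite invf_lt1// ltr1n.
  by move=> [x y] /= [xs ys]; exact: TL.
have [x xs xT] : exists2 x, S x & x = mkfun_fun TS x.
  by apply: banach_fixed_point => //; exists 0; rewrite /S /= normr0.
exists x; split=> //.
have : (G x - w) *m invmx A = 0.
  have xE : x = T x by exact: xT.
  by rewrite -[LHS](subKr x) -/(T x) -xE subrr.
move=> /(congr1 (mulmx^~ A)); rewrite mulmxKV// mul0mx => /eqP.
by rewrite subr_eq0 => /eqP.
Qed.

End LipschitzPerturbation.

(** Letting [e] tend to 0 kills the constant term; dividing by ['X] lowers both the size and the
    exponent by one. *)
Lemma poly_bigO_eq0 {R : realType} n (p : {poly R}) (C d : R) :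
  (size p <= n)%N -> 0 < d ->
  (forall e, 0 < e < d -> `|p.[e]| <= C * e ^+ n) -> p = 0.
Proof.
elim: n p => [|n IH] p; first by rewrite size_poly_leq0 => /eqP.
move=> sp d0 pC.
have p0 : p.[0] = 0.
  apply/eqP; rewrite -normr_le0 leNgt; apply/negP => p0.
  have p02 : 0 < `|p.[0]| / 2 by rewrite divr_gt0.
  have [d' d'0 d'P] := (continuous_eps (horner p) 0).1
    (@continuous_horner R p 0) _ p02.
  have C1 : 0 < `|C| + 1 by rewrite ltr_wpDl.
  pose e := Num.min 1 (Num.min d (Num.min d' (`|p.[0]| / 2 / (`|C| + 1)))) / 2.
  have m0 : 0 < Num.min 1 (Num.min d (Num.min d' (`|p.[0]| / 2 / (`|C| + 1)))).
    by rewrite !lt_min ltr01 d0 d'0 divr_gt0.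
  have e0 : 0 < e by rewrite divr_gt0.
  have em : e < Num.min 1 (Num.min d (Num.min d' (`|p.[0]| / 2 / (`|C| + 1)))).
    by rewrite /e; lra.
  move: em; rewrite !lt_min => /and4P[e1 ed ed' eC].
  have := d'P e; rewrite subr0 gtr0_norm// => /(_ ed') h1.
  have := pC e; rewrite e0 ed => /(_ isT) h2.
  have h3 : C * e ^+ n.+1 <= (`|C| + 1) * e.
    rewrite (le_trans (ler_norm _))// normrM [`|e ^+ _|]gtr0_norm ?exprn_gt0//.
    apply: ler_pM => //; [by rewrite exprn_ge0// ltW|by rewrite lerDl|].
    by rewrite exprS ler_piMr ?(ltW e0)// exprn_ile1// ltW.
  move: eC; rewrite ltr_pdivlMr// mulrC => h4.
  have := ler_normB p.[e] (p.[e] - p.[0]); rewrite subKr.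
  lra.
have pE : p = drop_poly 1 p * 'X.
  have := poly_take_drop 1 p; rewrite expr1 => {1}<-.
  rewrite -[RHS]add0r; congr (_ + _); apply/polyP => -[|i].
    by rewrite coef_take_poly coef0 /= -horner_coef0.
  by rewrite coef_take_poly coef0.
suff dp0 : drop_poly 1 p = 0 by rewrite pE dp0 mul0r.
apply: IH d0 _ => [|e /[dup] ed /pC]; first by rewrite size_drop_poly leq_subLR.
have [e0 _] := andP ed.
rewrite {1}pE hornerM hornerX normrM (gtr0_norm e0) exprSr mulrA.
by rewrite ler_pM2r.
Qed.

(** * Dilations, weights of monomials and Jacobian matrices *)

Section Dilations.
Context {R : realType} {N : nat} {sigma : 'I_N -> nat}.
Context (sigma_gt0 : forall j, (0 < sigma j)%N).
Implicit Types (x y : 'rV[R]_N) (e : R).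
Local Notation delta := (dilation sigma).

Definition dilation_mx e : 'M[R]_N := diag_mx (\row_j e ^+ sigma j).

Lemma dilation_mxE e x : delta e x = x *m dilation_mx e.
Proof. by apply/rowP => j; rewrite mul_mx_diag !mxE mulrC. Qed.

Lemma dilationM e e' x : delta e (delta e' x) = delta (e * e') x.
Proof. by apply/rowP => j; rewrite !mxE exprMn mulrA. Qed.

Lemma dilation1 x : delta 1 x = x.
Proof. by apply/rowP => j; rewrite !mxE expr1n mul1r. Qed.

Lemma dilationVK e x : 0 < e -> delta e^-1 (delta e x) = x.
Proof. by move=> e0; rewrite dilationM mulVf ?gt_eqF// dilation1. Qed.

Lemma dilationKV e x : 0 < e -> delta e (delta e^-1 x) = x.
Proof. by move=> e0; rewrite dilationM divff ?gt_eqF// dilation1. Qed.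

Lemma dilationB e x y : delta e (x - y) = delta e x - delta e y.
Proof. by rewrite !dilation_mxE mulmxBl. Qed.

Lemma dilation_at0 e : delta e 0 = 0.
Proof. by rewrite dilation_mxE mul0mx. Qed.

Lemma dilation_norm e x : 0 <= e <= 1 -> `|delta e x| <= e * `|x|.
Proof.
move=> /andP[e0 e1]; apply: row_norm_le => [|j]; first by rewrite mulr_ge0.
rewrite mxE normrM ler_pM ?row_coord_le//.
rewrite ger0_norm ?exprn_ge0// -(prednK (sigma_gt0 j)) exprS.
by rewrite ler_piMr// exprn_ile1.
Qed.

Lemma dilation_differentiable e x : differentiable (delta e) x /\
  forall v, 'd (delta e) x v = delta e v.
Proof.
have cm : continuous (mulmxr (dilation_mx e) : 'rV[R]_N -> 'rV[R]_N).
  exact: linear_row_continuous.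
have -> : delta e = mulmxr (dilation_mx e).
  by apply/funext => y; exact: dilation_mxE.
split; first exact: linear_differentiable.
by move=> v; exact: (congr1 (@^~ v) (diff_lin x cm)).
Qed.

Lemma det_dilation_mx e : \det (dilation_mx e) = \prod_j e ^+ sigma j.
Proof. by rewrite det_diag; apply: eq_bigr => j _; rewrite mxE. Qed.

End Dilations.

Section WordWeights.
Context {R : realType} {N : nat} (sigma : 'I_N -> nat).
Implicit Types (J : seq 'I_N) (x y : 'rV[R]_N).

Definition word_weight J : nat := \sum_(j <- J) sigma j.

Lemma word_monomial_dilation e J x :
  word_monomial J (dilation sigma e x) = e ^+ word_weight J * word_monomial J x.
Proof.
rewrite /word_monomial /word_weight; elim: J => [|j J IH].
  by rewrite !big_nil mul1r.
by rewrite !big_cons IH mxE exprD mulrACA.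
Qed.

Lemma word_monomial_le1 J x : `|x| <= 1 -> `|word_monomial J x| <= 1.
Proof.
move=> x1; rewrite /word_monomial; elim: J => [|j J IH].
  by rewrite big_nil normr1.
rewrite big_cons normrM mulr_ile1//.
exact: le_trans (row_coord_le _ _) x1.
Qed.

Lemma word_monomial_lipschitz J x y : `|x| <= 1 -> `|y| <= 1 ->
  `|word_monomial J x - word_monomial J y| <= (size J)%:R * `|x - y|.
Proof.
move=> x1 y1; elim: J => [|j J IH].
  by rewrite /word_monomial !big_nil subrr normr0 mul0r.
have mE z : word_monomial (j :: J) z = z 0 j * word_monomial J z.
  by rewrite /word_monomial big_cons.
rewrite !mE.
have -> : x 0 j * word_monomial J x - y 0 j * word_monomial J y =
  x 0 j * (word_monomial J x - word_monomial J y) +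
  (x - y) 0 j * word_monomial J y by rewrite !mxE; ring.
rewrite (le_trans (ler_normD _ _))// !normrM /= -natr1 mulrDl mul1r lerD//.
  rewrite (le_trans (ler_pM _ _ (row_coord_le x j) IH))//.
  by rewrite ler_piMl// mulr_ge0.
rewrite (le_trans (ler_pM _ _ (row_coord_le (x - y) j)
  (word_monomial_le1 J y1)))// mulr1//.
Qed.

Lemma Ck_word_monomial q k J (a : 'rV[R]_q) :
  Ck k setT (fun x => word_monomial J x *: a).
Proof.
elim: J => [|j J IH].
  by apply: Ck_eq (Ck_cst k setT a) => [|x _]; [exact: openT|
    rewrite /word_monomial big_nil scale1r].
have := Ck_scale j openT (Ck_id k setT) IH.
by apply: Ck_eq => [|x _]; [exact: openT|
  rewrite /word_monomial big_cons scalerA].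
Qed.

Lemma Ck_weval q k (P : seq ('rV[R]_q * seq 'I_N)) : Ck k setT (weval P).
Proof.
apply: (@Ck_sum _ _ _ _ _ _ P (fun aJ x => word_monomial aJ.2 x *: aJ.1)).
  exact: openT.
by move=> aJ; exact: Ck_word_monomial.
Qed.

End WordWeights.

Lemma mx_norm_le {R : realType} m n (A : 'M[R]_(m, n)) c :
  0 <= c -> (forall i j, `|A i j| <= c) -> `|A| <= c.
Proof.
move=> c0 Ac; rewrite /Num.Def.normr /= mx_normrE; apply/bigmax_leP; split=> //.
Qed.

Lemma det_continuous {R : realType} n :
  continuous (fun A : 'M[R]_n => \det A).
Proof.
apply: continuous_big => [|s _ A]; first exact: add_continuous.
apply: (@cvgM _ _ (nbhs A)); first exact: cvg_cst.
move: A; apply: continuous_big => [|i _]; first exact: mul_continuous.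
exact: coord_continuous.
Qed.

Lemma jacobian_mul {R : realType} n q (f : 'rV[R]_n -> 'rV[R]_q) x v :
  'd f x v = v *m jacobian f x.
Proof. by rewrite /jacobian mul_rV_lin1. Qed.

(** Converts smallness of the Lipschitz constant of [f - g] into closeness of differentials. The
    matrix norm is the largest entry, so testing on basis vectors suffices. *)
Lemma jacobian_dist {R : realType} n q (f g : 'rV[R]_n -> 'rV[R]_q) x
    (eta d : R) : differentiable f x -> differentiable g x -> 0 <= eta ->
  0 < d -> (forall h, `|h| < d ->
    `|(f (x + h) - g (x + h)) - (f x - g x)| <= eta * `|h|) ->
  `|jacobian f x - jacobian g x| <= eta.
Proof.
move=> df dg eta0 d0 fg; apply: mx_norm_le => // i j.
rewrite !mxE.
have -> : 'd f x 'e_i 0 j - 'd g x 'e_i 0 j = 'd (f - g) x 'e_i 0 j.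
  transitivity (('d f x 'e_i - 'd g x 'e_i) 0 j); first by rewrite !mxE.
  have E := congr1 (@^~ 'e_i) (diffB df dg).
  exact: esym (congr1 (fun v : 'rV[R]_q => v 0 j) E).
rewrite (le_trans (row_coord_le _ _))//.
have dfg : differentiable (f - g) x by exact: differentiableB.
by have := diff_lipschitz_le dfg eta0 d0 fg 'e_i; rewrite norm_delta_row mulr1.
Qed.

(** * Expansion of the rescaled map *)

Section Structure.
Context {R : realType} {N m : nat} {sigma : 'I_N -> nat}.
Context (sigma_gt0 : forall j, (0 < sigma j)%N)
  (sigma_le : forall j, (sigma j <= m.+1)%N).
Context {psi : 'rV[R]_N -> 'rV[R]_N} {P : seq ('rV[R]_N * seq 'I_N)}
  (psiP : lip_jet m psi P).
Local Notation delta := (dilation sigma).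
Local Notation wt := (word_weight sigma).

(** The selection depends on the component: a word may have the right weight for some components
    only, so coefficients are set to zero instead of dropping terms. *)
Definition weight_part : seq ('rV[R]_N * seq 'I_N) :=
  [seq (\row_k (if wt aJ.2 == sigma k then aJ.1 0 k else 0), aJ.2)
    | aJ : 'rV[R]_N * seq 'I_N <- P].

Definition homogeneous_part : 'rV[R]_N -> 'rV[R]_N := weval weight_part.
Local Notation L := homogeneous_part.

Definition scaled e : 'rV[R]_N -> 'rV[R]_N := delta e^-1 \o psi \o delta e.

Lemma homogeneous_partE x k :
  L x 0 k = \sum_(aJ <- P | wt aJ.2 == sigma k) word_monomial aJ.2 x * aJ.1 0 k.
Proof.
rewrite /homogeneous_part /weval big_map summxE [RHS]big_mkcond.
by apply: eq_bigr => aJ _; rewrite !mxE; case: ifP; rewrite ?mulr0.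
Qed.

Lemma homogeneous_part_dilation e x : L (delta e x) = delta e (L x).
Proof.
apply/rowP => k; rewrite mxE !homogeneous_partE mulr_sumr.
apply: eq_bigr => aJ /eqP wk.
by rewrite word_monomial_dilation wk mulrA.
Qed.

Lemma homogeneous_part0 : L 0 = 0.
Proof.
rewrite -{1}(dilation_at0 (sigma := sigma) 0) homogeneous_part_dilation.
by apply/rowP => k; rewrite !mxE expr0n gtn_eqF// mul0r.
Qed.

Context {C s e0 : R} (s_gt0 : 0 < s) (e0_gt0 : 0 < e0)
  (psiC : forall e x k, 0 < e < e0 -> `|x| < s ->
     `|psi (delta e x) 0 k| <= C * e ^+ sigma k).

(** At the origin the bound says that a constant is of order [e ^+ sigma k] with a positive
    exponent. In the application this shows that the chart sends [theta 0] to the origin. *)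
Lemma bounded_psi0 : psi 0 = 0.
Proof.
apply/rowP => k; rewrite mxE; apply/eqP.
rewrite -polyC_eq0; apply/eqP.
apply: (poly_bigO_eq0 (n := sigma k) (C := C)) e0_gt0 _.
  by rewrite (leq_trans (size_polyC_leq1 _)).
move=> e ee; rewrite hornerC.
by have := psiC k ee (x := 0); rewrite normr0 dilation_at0; exact.
Qed.

Lemma scaled0 e : scaled e 0 = 0.
Proof. by rewrite /scaled /= dilation_at0 bounded_psi0 dilation_at0. Qed.

Let rho u := psi u - weval P u.

Let rho0 : rho 0 = 0.
Proof. by rewrite /rho psiP.1 subrr. Qed.

(** The exponents of [e] that remain are positive because all terms of weight below [sigma k]
    vanish. Here [m.+1] is the degree of the Taylor polynomial, so the weights do not exceed it. *)
Lemma scaled_expansion : exists2 d, 0 < d & forall e x k, 0 < e < d ->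
  `|x| < Num.min 1 s ->
  scaled e x 0 k = L x 0 k +
    \sum_(aJ <- P | (sigma k < wt aJ.2)%N)
       e ^+ (wt aJ.2 - sigma k) * (word_monomial aJ.2 x * aJ.1 0 k) +
    e ^- sigma k * rho (delta e x) 0 k.
Proof.
have [d1 d10 d1P] := psiP.2 1 ltr01.
exists (Num.min 1 (Num.min e0 d1)); first by rewrite !lt_min ltr01 e0_gt0.
move=> e x k ed; rewrite lt_min => /andP[x1 xs].
have small e' : 0 < e' < Num.min 1 (Num.min e0 d1) ->
    [/\ 0 < e', 0 < e' < e0, e' <= 1 & `|rho (delta e' x)| <= e' ^+ m.+1].
  rewrite !lt_min => /and4P[e'0 e'1 e'e0 e'd].
  split=> //; [by rewrite e'0|exact: ltW|].
  have de : `|delta e' x| <= e'.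
    rewrite (le_trans (dilation_norm sigma_gt0 _ _)) ?(ltW e'0) ?(ltW e'1)//.
    by rewrite ler_piMr ?ltW.
  have z0 : `|0 : 'rV[R]_N| <= e' by rewrite normr0 ltW.
  have := d1P e' (delta e' x) 0 e'd de z0.
  rewrite -/(rho _) -/(rho 0) rho0 !subr0 mul1r => /le_trans; apply.
  by rewrite exprSr ler_wpM2l// exprn_ge0// ltW.
have wevalE e' : weval P (delta e' x) 0 k =
    \sum_(aJ <- P) e' ^+ wt aJ.2 * (word_monomial aJ.2 x * aJ.1 0 k).
  rewrite /weval summxE; apply: eq_bigr => aJ _.
  by rewrite mxE word_monomial_dilation mulrA.
pose low : {poly R} := \sum_(aJ <- P | (wt aJ.2 < sigma k)%N)
  (word_monomial aJ.2 x * aJ.1 0 k) *: 'X^(wt aJ.2).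
have lowE e' : low.[e'] = \sum_(aJ <- P | (wt aJ.2 < sigma k)%N)
    e' ^+ wt aJ.2 * (word_monomial aJ.2 x * aJ.1 0 k).
  rewrite /low horner_sum; apply: eq_bigr => aJ _.
  by rewrite hornerZ hornerXn mulrC.
pose high e' : R := \sum_(aJ <- P | (sigma k <= wt aJ.2)%N)
    e' ^+ wt aJ.2 * (word_monomial aJ.2 x * aJ.1 0 k).
have psiE e' : psi (delta e' x) 0 k = low.[e'] + high e' + rho (delta e' x) 0 k.
  have -> : psi (delta e' x) = weval P (delta e' x) + rho (delta e' x).
    by rewrite /rho subrKC.
  rewrite mxE wevalE lowE /high (bigID (fun aJ => (wt aJ.2 < sigma k)%N)) /=.
  by congr (_ + _ + _); apply: eq_bigl => aJ; rewrite -leqNgt.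
pose H := \sum_(aJ <- P) `|word_monomial aJ.2 x * aJ.1 0 k|.
(* [low] is the difference of three quantities of order [e ^+ sigma k]: [psi] by assumption
   (constant [C]), the terms of higher weight (constant [H]), and the remainder, bounded by
   [e ^+ m.+1] (constant 1). *)
have low0 : low = 0.
  apply: (@poly_bigO_eq0 _ (sigma k) low (C + H + 1)
    (Num.min 1 (Num.min e0 d1))).
  - rewrite (leq_trans (size_sum _ _ _))//; apply/bigmax_leqP_seq => aJ _ wk.
    by rewrite (leq_trans (size_scale_leq _ _)) ?size_polyXn.
  - by rewrite !lt_min ltr01 e0_gt0.
  move=> e' /small[e'0 e'e0 e'1 re'].
  have -> : low.[e'] = psi (delta e' x) 0 k - high e' - rho (delta e' x) 0 k.
    by rewrite psiE; ring.
  rewrite (le_trans (ler_normB _ _))// mulrDl mul1r lerD//; last first.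
    rewrite (le_trans (row_coord_le _ _))// (le_trans re')//.
    by rewrite ler_wiXn2l// ltW.
  rewrite (le_trans (ler_normB _ _))// mulrDl lerD//; first exact: psiC.
  rewrite /high /H mulr_suml (le_trans (ler_norm_sum _ _ _))// big_mkcond.
  apply: ler_sum => aJ _; case: ifP => wk; last first.
    by rewrite mulr_ge0// exprn_ge0// ltW.
  rewrite normrM mulrC ler_wpM2l// ger0_norm ?exprn_ge0 ?(ltW e'0)//.
  by rewrite ler_wiXn2l// ltW.
have [e_gt0 _ _ _] := small e ed.
have en0 : e ^+ sigma k != 0 by rewrite expf_neq0// gt_eqF.
rewrite /scaled /= mxE psiE low0 horner0 add0r exprVn mulrDr; congr (_ + _).
rewrite /high (bigID (fun aJ => wt aJ.2 == sigma k)) /= mulrDr; congr (_ + _).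
  rewrite homogeneous_partE mulr_sumr; apply: eq_big => [aJ|aJ /andP[_ /eqP->]].
    by rewrite eqn_leq; case: leqP; rewrite ?andbF.
  by rewrite mulrA mulVf// mul1r.
rewrite mulr_sumr; apply: eq_big => [aJ|aJ /andP[wk _]].
  by rewrite andbC eq_sym -ltn_neqAle.
by rewrite mulrA -{1}(subnK wk) exprD [_ * e ^+ sigma k]mulrC mulKf.
Qed.

(** Terms of weight above [sigma k] keep a factor [e]. The remainder has Lipschitz constant
    [eta / 2] times [e ^+ m] on the ball of radius [e], the dilation contributes one more [e], and
    [sigma k <= m.+1] lets the product compensate the division by [e ^+ sigma k]. *)
Lemma scaled_lipschitz (eta : R) : 0 < eta -> exists2 d, 0 < d &
  forall e x y, 0 < e < d -> `|x| < Num.min 1 s -> `|y| < Num.min 1 s ->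
    `|(scaled e x - L x) - (scaled e y - L y)| <= eta * `|x - y|.
Proof.
move=> eta0; have eta2 : 0 < eta / 2 by rewrite divr_gt0.
have [d1 d10 d1P] := scaled_expansion.
have [d2 d20 d2P] := psiP.2 _ eta2.
pose H := \sum_(aJ <- P) (size aJ.2)%:R * `|aJ.1|.
have H0 : 0 <= H by apply: sumr_ge0 => aJ _; rewrite mulr_ge0.
have H1 : 0 < H + 1 by rewrite ltr_wpDl.
exists (Num.min 1 (Num.min (eta / 2 / (H + 1)) (Num.min d1 d2))).
  by rewrite !lt_min ltr01 d10 d20 divr_gt0.
move=> e x y; rewrite !lt_min => /andP[e_gt0 /and4P[e1 eH ed1 ed2]] xs ys.
have [x1 y1] : `|x| <= 1 /\ `|y| <= 1.
  by split; apply: ltW; [case/andP: xs|case/andP: ys].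
apply: row_norm_le => [|k]; first by rewrite mulr_ge0// ltW.
have ed : 0 < e < d1 by rewrite e_gt0.
have hx := d1P e x k ed; have hy := d1P e y k ed.
have -> : ((scaled e x - L x) - (scaled e y - L y)) 0 k =
    \sum_(aJ <- P | (sigma k < wt aJ.2)%N) e ^+ (wt aJ.2 - sigma k) *
      ((word_monomial aJ.2 x - word_monomial aJ.2 y) * aJ.1 0 k) +
    e ^- sigma k * (rho (delta e x) - rho (delta e y)) 0 k.
  have -> : \sum_(aJ <- P | (sigma k < wt aJ.2)%N) e ^+ (wt aJ.2 - sigma k) *
      ((word_monomial aJ.2 x - word_monomial aJ.2 y) * aJ.1 0 k) =
    \sum_(aJ <- P | (sigma k < wt aJ.2)%N) e ^+ (wt aJ.2 - sigma k) *
      (word_monomial aJ.2 x * aJ.1 0 k) -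
    \sum_(aJ <- P | (sigma k < wt aJ.2)%N) e ^+ (wt aJ.2 - sigma k) *
      (word_monomial aJ.2 y * aJ.1 0 k).
    by rewrite -sumrB; apply: eq_bigr => aJ _; rewrite mulrBl mulrBr.
  have -> : ((scaled e x - L x) - (scaled e y - L y)) 0 k =
    (scaled e x 0 k - L x 0 k) - (scaled e y 0 k - L y 0 k) by rewrite !mxE.
  rewrite hx ?lt_min// hy ?lt_min// !mxE; ring.
rewrite (le_trans (ler_normD _ _))// [eta]splitr mulrDl lerD//.
  rewrite (@le_trans _ _ (e * H * `|x - y|))//; last first.
    rewrite ler_wpM2r//; move: eH; rewrite ltr_pdivlMr//; lra.
  rewrite /H mulr_sumr mulr_suml (le_trans (ler_norm_sum _ _ _))// big_mkcond.
  apply: ler_sum => aJ _; case: ifP => wk; last first.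
    by rewrite !mulr_ge0// ltW.
  rewrite !normrM -mulrA ler_pM//.
    rewrite ger0_norm ?exprn_ge0 ?(ltW e_gt0)//.
    have : (0 < wt aJ.2 - sigma k)%N by rewrite subn_gt0.
    case: (_ - _)%N => // j _; rewrite exprS ler_piMr ?(ltW e_gt0)//.
    by rewrite exprn_ile1// ltW.
  rewrite mulrAC; apply: ler_pM => //; last exact: row_coord_le.
  exact: word_monomial_lipschitz.
have e01 : 0 <= e <= 1 by rewrite !ltW.
have dx : `|delta e x| <= e.
  by rewrite (le_trans (dilation_norm sigma_gt0 _ e01))// ler_piMr// ltW.
have dy : `|delta e y| <= e.
  by rewrite (le_trans (dilation_norm sigma_gt0 _ e01))// ler_piMr// ltW.
have := d2P e _ _ ed2 dx dy; rewrite -/(rho _) -/(rho _) -dilationB => h.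
rewrite normrM gtr0_norm ?invr_gt0 ?exprn_gt0// ler_pdivrMl ?exprn_gt0//.
rewrite (le_trans (row_coord_le _ _))// (le_trans h)//.
have h2 := dilation_norm sigma_gt0 (x - y) e01.
rewrite (@le_trans _ _ (eta / 2 * e ^+ m * (e * `|x - y|)))//.
  by rewrite ler_wpM2l// mulr_ge0 ?exprn_ge0 ?ltW.
have -> : eta / 2 * e ^+ m * (e * `|x - y|) = eta / 2 * `|x - y| * e ^+ m.+1.
  by rewrite exprS; ring.
rewrite [leRHS]mulrC ler_wpM2l ?mulr_ge0 ?(ltW eta2)//.
  exact: ltW.
by rewrite ler_wiXn2l ?(ltW e_gt0) ?(ltW e1).
Qed.

End Structure.

(** * Limits of the rescaled maps and invertibility *)

Section StructureConsequences.
Context {R : realType} {N m : nat} {sigma : 'I_N -> nat}.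
Context (sigma_gt0 : forall j, (0 < sigma j)%N)
  (sigma_le : forall j, (sigma j <= m.+1)%N).
Context {psi : 'rV[R]_N -> 'rV[R]_N} {P : seq ('rV[R]_N * seq 'I_N)}
  (psiP : lip_jet m psi P).
Context {C s e0 : R} (s_gt0 : 0 < s) (e0_gt0 : 0 < e0)
  (psiC : forall e x k, 0 < e < e0 -> `|x| < s ->
     `|psi (dilation sigma e x) 0 k| <= C * e ^+ sigma k).
Context {r0 : R} (r0_gt0 : 0 < r0)
  (psi_diff : forall u, `|u| < r0 -> differentiable psi u)
  (psi_det : \det (jacobian psi 0) != 0).
Local Notation delta := (dilation sigma).
Local Notation L := (@homogeneous_part R N sigma P).
Local Notation F := (@scaled R N sigma psi).

Let scaled_lip :=
  @scaled_lipschitz _ _ _ _ sigma_gt0 sigma_le _ _ psiP _ _ _ e0_gt0 psiC.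
Let Fe0 e : F e 0 = 0 := scaled0 sigma_gt0 s_gt0 e0_gt0 psiC e.
Let L0 : L 0 = 0 := homogeneous_part0 sigma_gt0.
Let s1 := Num.min 1 s.
Let s1_gt0 : 0 < s1. Proof. by rewrite lt_min ltr01. Qed.

Lemma homogeneous_part_diff x : differentiable L x.
Proof.
have [dL _] := Ck_weval 1 (weight_part (sigma := sigma) (P := P)).
exact: dL.
Qed.

Lemma scaled_diff e x : 0 < e < Num.min 1 r0 -> `|x| < 1 ->
  differentiable (F e) x /\ forall v,
    'd (F e) x v = delta e^-1 ('d psi (delta e x) (delta e v)).
Proof.
rewrite lt_min => /and3P[e_gt0 e1 er] x1.
have e01 : 0 <= e <= 1 by rewrite !ltW.
have dx : `|delta e x| < r0.
  rewrite (le_lt_trans (dilation_norm sigma_gt0 _ e01))//.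
  rewrite (le_lt_trans _ er)// ler_piMr//; exact: ltW.
have [d1 d1E] := dilation_differentiable (sigma := sigma) e x.
have d2 := psi_diff dx.
have [d3 d3E] :=
  dilation_differentiable (sigma := sigma) e^-1 (psi (delta e x)).
have d12 : differentiable (psi \o delta e) x by exact: differentiable_comp.
split.
  exact: (@differentiable_comp _ _ _ _ (psi \o delta e) (delta e^-1)).
move=> v.
have E1 : 'd (F e) x v =
    'd (delta e^-1) (psi (delta e x)) ('d (psi \o delta e) x v).
  exact: (congr1 (@^~ v)
    (@diff_comp _ _ _ _ (psi \o delta e) (delta e^-1) x d12 d3)).
have E2 : 'd (psi \o delta e) x v = 'd psi (delta e x) ('d (delta e) x v).
  exact: (congr1 (@^~ v) (diff_comp d1 d2)).
exact: (etrans E1 (etrans (d3E _) (congr1 (delta e^-1)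
  (etrans E2 (congr1 ('d psi (delta e x)) (d1E v)))))).
Qed.

Lemma det_scaled e : 0 < e < Num.min 1 r0 ->
  \det (jacobian (F e) 0) = \det (jacobian psi 0).
Proof.
move=> er; have [_ FE] := scaled_diff er (x := 0) (ltac:(by rewrite normr0)).
have -> : jacobian (F e) 0 =
    dilation_mx (sigma := sigma) e *m jacobian psi 0
      *m dilation_mx (sigma := sigma) e^-1.
  apply/row_matrixP => i; rewrite !rowE -jacobian_mul FE.
  by rewrite dilation_mxE jacobian_mul dilation_mxE dilation_at0 !mulmxA.
rewrite !det_mulmx !det_dilation_mx mulrAC -big_split /= big1 ?mul1r// => j _.
by rewrite -exprMn divff ?expr1n// gt_eqF//; case/andP: er.
Qed.

Lemma jacobian_scaled_cvg (eta : R) : 0 < eta -> exists2 d, 0 < d &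
  forall e x, 0 < e < d -> `|x| < s1 ->
    `|jacobian (F e) x - jacobian L x| <= eta.
Proof.
move=> eta0; have [d d0 dP] := scaled_lip eta0.
exists (Num.min d (Num.min 1 r0)); first by rewrite !lt_min d0 ltr01.
move=> e x; rewrite lt_min => /and3P[e_gt0 ed er] xs.
have x1 : `|x| < 1 by move: xs; rewrite lt_min => /andP[].
have [dF _] := scaled_diff (e := e) (ltac:(by rewrite e_gt0)) x1.
apply: (@jacobian_dist _ _ _ (F e) L x eta (s1 - `|x|)) => //.
- exact: homogeneous_part_diff.
- exact: ltW.
- by rewrite subr_gt0.
move=> h hs; have xh : `|x + h| < s1.
  by rewrite (le_lt_trans (ler_normD _ _))//; lra.
have := dP e (x + h) x; rewrite e_gt0 ed => /(_ isT xh xs).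
by rewrite [x + h - x]addrAC subrr add0r.
Qed.

(** Both maps vanish at 0, so the Lipschitz estimate against 0 is already the uniform one. *)
Lemma scaled_cvg (eta : R) : 0 < eta -> exists2 d, 0 < d &
  forall e x, 0 < e < d -> `|x| < s1 -> `|F e x - L x| <= eta.
Proof.
move=> eta0; have [d d0 dP] := scaled_lip eta0.
exists d => // e x ed xs; have z0 : `|0 : 'rV[R]_N| < s1 by rewrite normr0.
have := dP e x 0 ed xs z0; rewrite Fe0 L0 !subr0 => /le_trans; apply.
rewrite ler_piMr ?(ltW eta0)// ltW//.
by move: xs; rewrite lt_min => /andP[].
Qed.

(** The determinant of the rescaled Jacobian is constant in [e], and determinants pass to the limit
    by continuity. *)
Lemma det_homogeneous_part : \det (jacobian L 0) = \det (jacobian psi 0).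
Proof.
apply/eqP; rewrite -subr_eq0 -normr_le0.
apply/ler_addgt0Pr => eta eta0; rewrite add0r.
have [d d0 dP] :=
  (continuous_eps _ _).1 (@det_continuous R N (jacobian L 0)) _ eta0.
have d20 : 0 < d / 2 by rewrite divr_gt0.
have [d' d'0 d'P] := jacobian_scaled_cvg d20.
pose e := Num.min d' (Num.min 1 r0) / 2.
have m0 : 0 < Num.min d' (Num.min 1 r0) by rewrite !lt_min d'0 ltr01.
have e_gt0 : 0 < e by rewrite divr_gt0.
have : e < Num.min d' (Num.min 1 r0) by rewrite /e; lra.
rewrite lt_min => /andP[ed' er].
have er2 : 0 < e < Num.min 1 r0 by rewrite e_gt0.
suff key z : \det (jacobian (F e) 0) = z -> `|\det (jacobian L 0) - z| <= eta.
  exact: key (det_scaled er2).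
move=> <-; rewrite distrC ltW// dP//.
have z0 : `|0 : 'rV[R]_N| < s1 by rewrite normr0.
have := d'P e 0; rewrite e_gt0 ed' => /(_ isT z0) h.
by rewrite (le_lt_trans h)//; lra.
Qed.

Let A := jacobian L 0.

Let A_unit : A \in unitmx.
Proof. by rewrite unitmxE unitfE det_homogeneous_part. Qed.

(** [L] is polynomial, hence strictly differentiable at 0. The constant [(4 * K)^-1] leaves room for
    an equal error from the rescaled map within the [(2 * K)^-1] that the contraction tolerates. *)
Lemma homogeneous_part_perturbation : exists K s2 : R,
  [/\ 0 < K, forall v : 'rV[R]_N, `|v *m invmx A| <= K * `|v|, 0 < s2 < s1 &
    forall x y, `|x| <= s2 -> `|y| <= s2 ->
      `|L x - L y - (x - y) *m A| <= (4 * K)^-1 * `|x - y|].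
Proof.
have [K K0 KP] := linear_row_bounded
  (mulmxr (invmx A) : {linear 'rV[R]_N -> 'rV[R]_N}).
have K4 : 0 < (4 * K)^-1 by rewrite invr_gt0 mulr_gt0.
have [d d0 dP] := C1_strict openT I
  (Ck_weval 1 (weight_part (sigma := sigma) (P := P))) (x := 0) K4.
pose s2 := Num.min d s1 / 2.
have m0 : 0 < Num.min d s1 by rewrite lt_min d0.
have s20 : 0 < s2 by rewrite divr_gt0.
have : s2 < Num.min d s1 by rewrite /s2; lra.
rewrite lt_min => /andP[s2d s2s].
exists K, s2; split=> //; first by rewrite s20.
move=> x y xs ys; have := dP x y; rewrite !subr0.
move=> /(_ (le_lt_trans xs s2d) (le_lt_trans ys s2d)).
by rewrite (jacobian_mul L).
Qed.

(** The radius [c] is independent of [e]; this uniformity is what turns into an inclusion of boxes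
    after dilating back. *)
Lemma scaled_surjective : exists s2 c d : R, [/\ 0 < s2 < s1, 0 < c, 0 < d &
  forall e w, 0 < e < d -> `|w| <= c -> exists x, `|x| <= s2 /\ F e x = w].
Proof.
have [K [s2 [K0 KP s2s LP]]] := homogeneous_part_perturbation.
have [s20 s21] := andP s2s.
have K4 : 0 < (4 * K)^-1 by rewrite invr_gt0 mulr_gt0.
have [d d0 dP] := scaled_lip K4.
exists s2, (s2 / (2 * K)), d; split=> //; first by rewrite divr_gt0 ?mulr_gt0.
move=> e w ed ws.
apply: (perturbation_surjective (A := A) (K := K) (c := (2 * K)^-1)) => //.
- exact: ltW.
- by rewrite invfM mulrCA divff ?mulr1// gt_eqF.
- move=> x y xs ys.
  have -> : F e x - F e y - (x - y) *m A =
      ((F e x - L x) - (F e y - L y)) + (L x - L y - (x - y) *m A).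
    by apply/rowP => i; rewrite !mxE; ring.
  rewrite (le_trans (ler_normD _ _))//.
  have -> : (2 * K)^-1 = (4 * K)^-1 + (4 * K)^-1 by field; rewrite gt_eqF.
  rewrite mulrDl lerD//; last exact: LP.
  by apply: dP => //; exact: le_lt_trans s21.
- by rewrite Fe0 subr0.
Qed.

(** One factor serves the whole unit ball around [x], since continuity of the inverse of [L]
    involves neighbouring points as well. *)
Let shrink (b : R) x : 0 < b -> exists2 e, 0 < e <= 1 &
  forall y, `|y - x| <= 1 -> `|delta e y| <= b.
Proof.
move=> b0; have x1 : 0 < `|x| + 1 by rewrite ltr_wpDl.
pose e := Num.min 1 (b / (`|x| + 1)).
have e_gt0 : 0 < e by rewrite lt_min ltr01 divr_gt0.
have e1 : e <= 1 by rewrite ge_min lexx.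
have eb : e <= b / (`|x| + 1) by rewrite ge_min lexx orbT.
exists e => [|y yx]; first by rewrite e_gt0.
rewrite (le_trans (dilation_norm sigma_gt0 _ _)) ?(ltW e_gt0)//.
have yb : `|y| <= `|x| + 1.
  by rewrite -(subrK x y) addrC (le_trans (ler_normD _ _))// lerD2l.
rewrite (le_trans (ler_wpM2l (ltW e_gt0) yb))//.
by rewrite -ler_pdivlMr.
Qed.

(* Local invertibility at the origin is spread over the whole space by the
   dilations. *)
Lemma homogeneous_part_homeomorphism : homeomorphism L.
Proof.
have [K [s2 [K0 KP s2s LP]]] := homogeneous_part_perturbation.
have [s20 s21] := andP s2s.
have Kc : K * (4 * K)^-1 <= 2^-1.
  by rewrite invfM mulrCA divff ?gt_eqF// mulr1; lra.
have Linj := perturbation_injective A_unit (ltW K0) Kc KP LP.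
have Lsur := perturbation_surjective A_unit (ltW s20) K0 Kc KP LP.
pose b := s2 / (2 * K).
have b0 : 0 < b by rewrite divr_gt0 ?mulr_gt0.
have xx1 (x : 'rV[R]_N) : `|x - x| <= 1 by rewrite subrr normr0.
have inj x y : L x = L y -> x = y.
  move=> Lxy; have [e /andP[e_gt0 e1] eP] := shrink x s20.
  have [e' /andP[e'_gt0 e'1] e'P] := shrink y s20.
  (* Dilations by factors at most 1 do not increase the norm, so the product brings both points into
     the small ball. *)
  pose a := e * e'.
  have a0 : 0 < a by rewrite mulr_gt0.
  have e01 : 0 <= e <= 1 by rewrite (ltW e_gt0).
  have e'01 : 0 <= e' <= 1 by rewrite (ltW e'_gt0).
  have ax : `|delta a x| <= s2.
    rewrite /a mulrC -dilationM (le_trans (dilation_norm sigma_gt0 _ e'01))//.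
    by rewrite (le_trans _ (eP _ (xx1 x)))// ler_piMl.
  have ay : `|delta a y| <= s2.
    rewrite /a -dilationM (le_trans (dilation_norm sigma_gt0 _ e01))//.
    by rewrite (le_trans _ (e'P _ (xx1 y)))// ler_piMl.
  have := Linj _ _ ax ay; rewrite !homogeneous_part_dilation Lxy subrr normr0.
  rewrite mulr0 normr_le0 subr_eq0 => /eqP axy.
  by rewrite -(dilationVK (sigma := sigma) x a0) axy dilationVK.
have sur y : exists x, L x = y.
  have [e /andP[e_gt0 e1] eP] := shrink y b0.
  have := Lsur (delta e y); rewrite L0 subr0 => /(_ (eP _ (xx1 y)))[x [_ Lx]].
  by exists (delta e^-1 x); rewrite homogeneous_part_dilation Lx dilationVK.
have [g gK] : exists g : 'rV[R]_N -> 'rV[R]_N, forall y, L (g y) = y.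
  suff /choice : forall y, exists x, L x = y.
    by case=> f fP; exists f.
  exact: sur.
split.
  by move=> x; apply: differentiable_continuous; exact: homogeneous_part_diff.
exists g; split=> // [x|]; first by apply: inj; rewrite gK.
move=> y; apply/continuous_eps => eta eta0.
have [e /andP[e_gt0 e1] eP] := shrink y b0.
have gdel z : g (delta e z) = delta e (g z).
  by apply: inj; rewrite gK homogeneous_part_dilation gK.
have gsmall w : `|w| <= b -> `|g w| <= s2.
  move=> wb; have := Lsur w; rewrite L0 subr0 => /(_ wb)[x [xs Lx]].
  by have <- : x = g w by apply: inj; rewrite gK.
(* The inverse commutes with dilations: shrink by [e], use its Lipschitz constant [2 * K] near 0,
   and dilate back at the cost of [k]. *)
have [k k0 kP] := linear_row_bounded
  (mulmxr (dilation_mx (sigma := sigma) e^-1) : {linear 'rV[R]_N -> 'rV[R]_N}).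
have k'0 : 0 < k * (2 * K) by rewrite !mulr_gt0.
exists (Num.min 1 (eta / (k * (2 * K)))).
  by rewrite lt_min ltr01 divr_gt0.
move=> z; rewrite lt_min => /andP[z1 zeta].
have ez := eP _ (ltW z1); have ey := eP _ (xx1 y).
rewrite -(dilationVK (sigma := sigma) (g z) e_gt0).
rewrite -(dilationVK (sigma := sigma) (g y) e_gt0) -!gdel -dilationB.
rewrite dilation_mxE (le_lt_trans (kP _))//.
have h := Linj _ _ (gsmall _ ez) (gsmall _ ey).
rewrite !gK -dilationB in h.
have e01 : 0 <= e <= 1 by rewrite (ltW e_gt0).
have h2 := dilation_norm sigma_gt0 (z - y) e01.
have h3 : `|delta e (z - y)| <= `|z - y|.
  by rewrite (le_trans h2)// ler_piMl.
move: zeta; rewrite ltr_pdivlMr// => zeta.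
rewrite (le_lt_trans _ zeta)// [leRHS]mulrC -mulrA.
rewrite ler_wpM2l ?(ltW k0)// (le_trans h)// ler_wpM2l//.
by rewrite mulr_ge0// ltW.
Qed.

End StructureConsequences.

(** * Coordinates of the first kind read in the given chart *)

Lemma uniform_eps {R : realType} (T : choiceType) (W : normedModType R)
    (G : R -> T -> W) (f : T -> W) (V : set T) :
  {uniform V, G e @[e --> 0^'+] --> f} <->
  forall eta : R, 0 < eta -> exists2 d, 0 < d &
    forall e x, 0 < e < d -> V x -> `|G e x - f x| < eta.
Proof.
split=> [Gf eta eta0|Gf Q /= /uniform_nbhs[E [entE EQ]]].
  have nE : nbhs (f : {uniform` V -> W})
      [set h : T -> W | forall x, V x -> `|h x - f x| < eta].
    apply/uniform_nbhs; exists [set xy : W * W | ball xy.1 eta xy.2].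
    split; first by rewrite -entourage_ballE; exists eta.
    by move=> h hP x Vx; have := hP x Vx; rewrite /= -ball_normE /= distrC.
  have : \forall e \near (0 : R)^'+, forall x, V x -> `|G e x - f x| < eta.
    exact: Gf nE.
  move=> [d /= d0 dP]; exists d => // e x /andP[e_gt0 ed]; apply: dP => //=.
  by rewrite sub0r normrN gtr0_norm.
move: entE; rewrite -entourage_ballE => -[eta /= eta0 etaE].
have [d d0 dP] := Gf _ eta0.
exists d => //= e /=; rewrite sub0r normrN => ed e_gt0.
apply: EQ => x Vx; apply: etaE; rewrite /= -ball_normE /= distrC.
by apply: dP => //; rewrite e_gt0 -(gtr0_norm e_gt0).
Qed.

Lemma BoxE {R : realType} N (sigma : 'I_N -> nat) (r : R) x :
  (forall j, (0 < sigma j)%N) -> 0 < r ->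
  Box sigma r x <-> forall k, `|x 0 k| < r ^+ sigma k.
Proof.
move=> sigma_gt0 r0.
have E k : (`|x 0 k| `^ (sigma k)%:R^-1 < r) = (`|x 0 k| < r ^+ sigma k).
  have xE : `|x 0 k| = (`|x 0 k| `^ (sigma k)%:R^-1) ^+ sigma k.
    by rewrite -powR_mulrn ?powR_ge0// -powRrM mulVf ?powRr1// pnatr_eq0 -lt0n.
  rewrite [in RHS]xE ltr_pXn2r// ?nnegrE ?powR_ge0//.
  exact: ltW.
split=> [/bigmax_ltP[_ xr] k|xr]; first by rewrite -E; exact: xr.
by apply/bigmax_ltP; split=> // k _; rewrite E.
Qed.

Lemma weight_bounds {R : realType} {N m k : nat} {M : cc_space R N k m}
    (U : set M) (X : 'I_N -> M -> 'rV[R]_N) j :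
  (0 < weight U X j <= m)%N.
Proof.
rewrite /weight big_nat_cond; apply: (big_ind (fun l => 0 < l <= m)%N).
- by rewrite (cc_depth M) leqnn.
- move=> a b /andP[a0 am] /andP[b0 bm].
  by rewrite leq_min a0 b0 /= geq_min am.
- by move=> l /andP[].
Qed.

Lemma lip_jet_eq {R : realType} {N q d : nat} (f g : 'rV[R]_N -> 'rV[R]_q) P
    (r : R) : 0 < r -> (forall u, `|u| < r -> f u = g u) ->
  lip_jet d f P -> lip_jet d g P.
Proof.
move=> r0 fg [f0 fP]; split; first by rewrite -fg ?normr0.
move=> eta eta0; have [e e0 eP] := fP _ eta0.
exists (Num.min e r); first by rewrite lt_min e0.
move=> s u v; rewrite lt_min => /andP[se sr] us vs.
by rewrite -!fg; [exact: eP|exact: le_lt_trans sr|exact: le_lt_trans sr].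
Qed.

(** Spanning rows make multiplication by the matrix surjective, and preimages of the standard basis
    form a one-sided inverse. *)
Lemma basis_matrix_unit {R : realType} {N : nat} (X : 'I_N -> 'rV[R]_N) :
  basis_of fullv [seq X j | j <- enum 'I_N] -> \matrix_j X j \in unitmx.
Proof.
move=> /andP[/eqP spanX _]; set A := \matrix_j X j.
have surj (w : 'rV[R]_N) : exists v, v *m A = w.
  have : w \in limg (linfun (mulmxr A : 'rV[R]_N -> 'rV[R]_N)).
    have /subvP : (<<[seq X j | j <- enum 'I_N]>>
        <= limg (linfun (mulmxr A : 'rV[R]_N -> 'rV[R]_N)))%VS.
      apply/span_subvP => _ /mapP[j _ ->].
      have -> : X j = linfun (mulmxr A : 'rV[R]_N -> 'rV[R]_N) (delta_mx 0 j).
        by rewrite lfunE /= -rowE rowK.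
      exact: memv_img (memvf _).
    by apply; rewrite spanX memvf.
  by move=> /memv_imgP[v _ ->]; exists v; rewrite lfunE.
have [B BP] : exists B : 'I_N -> 'rV[R]_N, forall i, B i *m A = delta_mx 0 i.
  suff /choice : forall i, exists b : 'rV[R]_N, b *m A = delta_mx 0 i.
    by case=> f fP; exists f.
  by move=> i; exact: surj.
have BA : (\matrix_i B i) *m A = 1%:M.
  by apply/row_matrixP => i; rewrite row_mul rowK BP rowE mulmx1.
by have [] := mulmx1_unit BA.
Qed.

Lemma jacobian_unit_inverse {R : realType} {N : nat}
    (f g : 'rV[R]_N -> 'rV[R]_N) x :
  differentiable f x -> differentiable g (f x) ->
  (\near x, g (f x) = x) -> jacobian f x \in unitmx.
Proof.
move=> df dg gf.
have gfid : \near x, idfun x = (g \o f) x :> 'rV[R]_N.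
  by apply: filterS gf => y /= ->.
have did : differentiable (@idfun 'rV[R]_N) x.
  by apply: linear_differentiable => y; exact: cvg_id.
have [_ E] := near_eq_differentiable gfid did.
have fgE : jacobian f x *m jacobian g (f x) = 1%:M.
  apply/row_matrixP => i; rewrite row_mul !rowE mulmx1 -!jacobian_mul.
  have E1 : 'd (g \o f) x (delta_mx 0 i) =
      'd g (f x) ('d f x (delta_mx 0 i)).
    exact: (congr1 (@^~ (delta_mx 0 i)) (diff_comp df dg)).
  have E2 : 'd (@idfun 'rV[R]_N) x (delta_mx 0 i) = delta_mx 0 i.
    apply: (congr1 (@^~ (delta_mx 0 i))
      (@diff_lin _ _ _ (@idfun 'rV[R]_N) x _)).
    by move=> y; exact: cvg_id.
  exact: etrans (esym E1) (etrans (congr1 (@^~ (delta_mx 0 i)) E) E2).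
have [Uf _] := mulmx1_unit fgE.
exact: Uf.
Qed.

Lemma tcoord_chart_at {R : realType} {N : nat} (M : smooth_manifold R N)
    (p : M) v : tcoord (chart_at p) p v = v.
Proof.
set c := chart_at p; rewrite /tcoord -/c.
have cp : csrc c p by exact: chart_at_src.
have nt : nbhs (cmap c p) (ctgt c).
  by apply: open_nbhs_nbhs; split; [exact: ctgt_open|exact: cmap_in].
have idE : \forall y \near cmap c p, idfun y = (cmap c \o cinv c) y.
  by apply: filterS nt => y ty /=; rewrite cinvK.
have cid : continuous (@idfun 'rV[R]_N) by move=> y; exact: cvg_id.
have [_ E] := near_eq_differentiable idE (linear_differentiable (cmap c p) cid).
exact: etrans (congr1 (@^~ v) E) (congr1 (@^~ v) (diff_lin (cmap c p) cid)).
Qed.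

Lemma flow_diff0 {R : realType} {N : nat} {Y : 'I_N -> 'rV[R]_N -> 'rV[R]_N}
    {y0 : 'rV[R]_N} {r r0 B K : R} {c : 'rV[R]_N -> R -> 'rV[R]_N} :
  ray_flow Y y0 r r0 B K c ->
  differentiable (fun u => c u 1) 0 /\
  forall v, 'd (fun u => c u 1) 0 v = v *m \matrix_j Y j y0.
Proof.
move=> F; have [C [C0 CP]] := flow_strict_diff0 F.
have AE u : field_comb Y u y0 = u *m \matrix_j Y j y0.
  by rewrite mulmx_sum_row; apply: eq_bigr => j _; rewrite rowK.
have z1 : 0 <= (1 : R) <= 1 by rewrite ler01 lexx.
have cA : continuous (mulmxr (\matrix_j Y j y0) : 'rV[R]_N -> 'rV[R]_N).
  exact: linear_row_continuous.
have [|dF FE] := eps_differentiable (f := fun u => c u 1) (x := 0) cA.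
  move=> eta eta0; have C1 : 0 < C + 1 by rewrite ltr_wpDl.
  exists (Num.min r0 (eta / (C + 1))).
    by rewrite lt_min (rf_r0 F) divr_gt0.
  move=> h; rewrite lt_min => /andP[hr he].
  have z0 : `|0 : 'rV[R]_N| <= `|h| by rewrite normr0.
  have := CP `|h| h 0 1 (lexx _) z0 hr z1.
  rewrite add0r !scale1r !AE mul0mx !subr0.
  have -> : c h 1 - h *m (\matrix_j Y j y0) - c 0 1 =
      c h 1 - c 0 1 - h *m (\matrix_j Y j y0) by rewrite addrAC.
  move=> /le_trans; apply; rewrite ler_wpM2r//.
  by move: he; rewrite ltr_pdivlMr//; have := normr_ge0 h; nra.
by split=> // v; exact: (congr1 (@^~ v) FE).
Qed.

(** Near 0, [psi] is the time-one flow in the preferred chart at [p] followed by the transition map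
    [tau] to [Phi]. As [tau] is C^m, the jet has index [m.-1], that is degree [m]. The Jacobian at 0
    is the matrix of the basis at [p] times that of [tau], and both are invertible. *)
Lemma exp_coordinates_jet {R : realType} {N m : nat} (M : cc_space R N m m)
    (p : M) (U : set M) (X : 'I_N -> M -> 'rV[R]_N) (theta : 'rV[R]_N -> M)
    (Phi : chart R N M) (psi := cmap Phi \o theta) :
  U p -> subordinate_basis U X -> canonical_coordinates U X p theta ->
  (forall c, atlas c -> Ck_compatible m Phi c) -> csrc Phi p ->
  exists r0 P, [/\ 0 < r0, lip_jet m.-1 psi P,
    forall u, `|u| < r0 -> differentiable psi u,
    \det (jacobian psi 0) != 0 &
    forall u, `|u| < r0 -> cinv Phi (psi u) = theta u].
Proof.
move=> Up [oU XCm Xbasis _] thetaP PhiC Phip.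
have m0 := cc_depth M; have mE : m.-1.+1 = m by rewrite prednK.
pose c := chart_at p; pose y0 := cmap c p.
have ac : atlas c by exact: chart_at_atlas.
have cp : csrc c p by exact: chart_at_src.
pose T := cmap c @` (csrc Phi `&` csrc c).
have oT : open T by apply: chart_image_open; exact: csrc_open.
have Ty0 : T y0 by exists p.
have [rT /= rT0 rTP] := (nbhs_ballP _ _).1 (open_nbhs_nbhs (conj oT Ty0)).
have XC1 j : Ck_vector_field 1 U (X j).
  by move=> d ad; exact: Ck_le m0 (XCm j d ad).
have [r [r0 [B [K [g [/andP[r_gt0 rrT] F rA gtheta]]]]]] :=
  exp_ray_flow oU Up XC1 thetaP rT0.
rewrite -/c -/y0 in F rA gtheta.
(* On [A] both the fields read in [c] and the transition map [tau] are C^m. *)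
pose A := cmap c @` (U `&` csrc c) `&` T.
have oA : open A by apply: openI => //; exact: chart_image_open.
have ballA y : `|y - y0| < r -> A y.
  move=> yr; split; first exact: rA.
  by apply: rTP; rewrite -ball_normE /= distrC (lt_le_trans yr).
have Ay0 : A y0 by apply: ballA; rewrite subrr normr0.
pose Y j := vf_in c (X j).
have YC j : Ck m A (Y j).
  by apply: Ck_sub (XCm j c ac) => y [].
pose tau := cmap Phi \o cinv c.
have [PhiC1 PhiC2] := PhiC c ac.
have tauC : Ck m A tau by apply: Ck_sub PhiC2 => y [].
have tauC1 : Ck 1 A tau by exact: Ck_le tauC.
have r00 := rf_r0 F.
have z1 : 0 <= (1 : R) <= 1 by rewrite ler01 lexx.
have psiE u : `|u| < r0 -> tau (g u 1) = psi u.
  by move=> ur; have [ct ->] := gtheta u ur; rewrite /tau /psi /= cmapK.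
have Yd u y : `|y - y0| < r -> differentiable (field_comb Y u) y /\
    strict_diff (field_comb Y u) y ('d (field_comb Y u) y).
  move=> /ballA Ay.
  have C1 : Ck 1 A (field_comb Y u).
    exact: (@Ck_sum _ _ _ _ _ _ (index_enum _) (fun j y => u 0 j *: Y j y) oA
      (fun j => Ck_scale j oA (Ck_cst 1 A u) (Ck_le m0 (YC j)))).
  by have [dC _] := C1; split; [exact: dC|exact: C1_strict oA Ay C1].
have dtau y : `|y - y0| < r -> differentiable tau y.
  by move=> /ballA Ay; have [dt _] := tauC1; exact: dt.
have g_at0 := flow_at0 F.
have near_psi u : `|u| < r0 -> \near u, (tau \o (fun w => g w 1)) u = psi u.
  move=> ur; apply/nbhs_ballP; exists (r0 - `|u|); first by rewrite /= subr_gt0.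
  move=> w; rewrite -ball_normE /= => wu; apply: psiE.
  have := ler_normB u (u - w); rewrite subKr; lra.
have dg u : `|u| < r0 -> differentiable (fun w => g w 1) u.
  exact: (flow_differentiable F Yd).
have dpsi u : `|u| < r0 ->
    differentiable psi u /\
    'd psi u = 'd (tau \o (fun w => g w 1)) u :> (_ -> _).
  move=> ur; apply: near_eq_differentiable; first exact: near_psi.
  apply: differentiable_comp; first exact: dg.
  by apply: dtau; exact: (rf_in F).
have [P PP] : exists P, lip_jet m.-1 (fun u => tau (g u 1)) P.
  apply: (lip_jet_flow F oA ballA) => [j|].
    by apply: Ck_le (YC j); exact: leq_pred.
  by rewrite mE.
exists r0, P; split=> //.
- exact: lip_jet_eq r00 psiE PP.
- by move=> u /dpsi[].
- have z0 : `|0 : 'rV[R]_N| < r0 by rewrite normr0.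
  have [dg0 gE] := flow_diff0 F.
  have dt0 : differentiable tau (g 0 1).
    by apply: dtau; rewrite g_at0 subrr normr0.
  have jE : jacobian psi 0 = (\matrix_j Y j y0) *m jacobian tau (g 0 1).
    have [_ E] := dpsi 0 z0.
    apply/row_matrixP => i; rewrite row_mul !rowE -!jacobian_mul.
    have E1 : 'd (tau \o (fun w => g w 1)) 0 (delta_mx 0 i) =
        'd tau (g 0 1) ('d (fun w => g w 1) 0 (delta_mx 0 i)).
      exact: (congr1 (@^~ (delta_mx 0 i)) (diff_comp dg0 dt0)).
    exact: (etrans (congr1 (@^~ (delta_mx 0 i)) E)
      (etrans E1 (congr1 ('d tau (g 0 1)) (gE (delta_mx 0 i))))).
  have Xu : \matrix_j Y j y0 \in unitmx.
    have -> : \matrix_j Y j y0 = \matrix_j X j p.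
      apply/row_matrixP => j; rewrite !rowK /Y /vf_in /y0 cmapK//.
      exact: tcoord_chart_at.
    exact: basis_matrix_unit (Xbasis p Up).
  have tu : jacobian tau (g 0 1) \in unitmx.
    have tp : tau y0 = cmap Phi p by rewrite /tau /y0 /= cmapK.
    apply: (@jacobian_unit_inverse _ _ tau (cmap c \o cinv Phi)) => //.
      have [dt _] :
          Ck 1 (cmap Phi @` (csrc Phi `&` csrc c)) (cmap c \o cinv Phi).
        exact: Ck_le PhiC1.
      by rewrite g_at0 tp; apply: dt; exists p.
    have nT : nbhs (g 0 1) T by rewrite g_at0; exact: open_nbhs_nbhs.
    by apply: filterS nT => _ [x [px cx] <-]; rewrite /tau /= !cmapK.
  by rewrite jE det_mulmx mulf_neq0// -unitfE -unitmxE.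
move=> u ur; have [ct gE] := gtheta u ur.
have [_ [x [px cx] xg]] := ballA _ (rf_in F ur z1).
have <- : x = theta u by rewrite -(cmapK cx) xg gE cmapK.
rewrite -psiE// -xg /tau /= cmapK// cmapK//.
Qed.

Definition dilation_bounded {R : realType} {N : nat} (sigma : 'I_N -> nat)
    (psi : 'rV[R]_N -> 'rV[R]_N) : Prop :=
  exists C s e0 : R, [/\ 0 < s, 0 < e0 & forall e x k, 0 < e < e0 -> `|x| < s ->
    `|psi (dilation sigma e x) 0 k| <= C * e ^+ sigma k].

(** The first inclusion dilates back the uniform surjectivity; the second is the bound itself, read
    at scale [e / s2]. The conditions on the norm of [u] are recorded because [theta] is recovered
    from [psi] only near the origin. *)
Lemma dilation_bounded_box {R : realType} {N m : nat} {sigma : 'I_N -> nat}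
    {psi : 'rV[R]_N -> 'rV[R]_N} {P : seq ('rV[R]_N * seq 'I_N)} {r0 : R} :
  (forall j, (0 < sigma j)%N) -> (forall j, (sigma j <= m.+1)%N) ->
  lip_jet m psi P -> 0 < r0 ->
  (forall u, `|u| < r0 -> differentiable psi u) ->
  \det (jacobian psi 0) != 0 -> dilation_bounded sigma psi ->
  exists C1 C2 e0 : R, [/\ 0 < C1, C1 <= C2, 0 < e0 & forall e, 0 < e < e0 ->
    (forall w, Box sigma (C1 * e) w ->
       exists u, [/\ Box sigma e u, `|u| < r0 & psi u = w]) /\
    (forall u, Box sigma e u -> `|u| < r0 /\ Box sigma (C2 * e) (psi u))].
Proof.
move=> sigma_gt0 sigma_le psiP r00 dpsi psi_det [C [s [e0 [s0 e00 psiC]]]].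
have [s2 [c [d [/andP[s20 s2s] c0 d0 surj]]]] := scaled_surjective sigma_gt0
  sigma_le psiP s0 e00 psiC r00 dpsi psi_det.
have [s21 s2s'] : s2 < 1 /\ s2 < s by move: s2s; rewrite lt_min => /andP.
have powle (a : R) k : 0 < a <= 1 -> a ^+ sigma k <= a.
  move=> /andP[a0 a1]; rewrite -(prednK (sigma_gt0 k)) exprS.
  by rewrite ler_piMr ?(ltW a0)// exprn_ile1// ltW.
(* [C1 <= 1] makes every positive power of [C1] at most [c]; [a] is at least 1 and exceeds [C], so
   its positive powers exceed [C]. *)
pose C1 := Num.min 1 c; pose a := `|C| + 1.
have a1 : 1 <= a by rewrite lerDr.
have a0 : 0 < a by exact: lt_le_trans a1.
have C10 : 0 < C1 by rewrite lt_min ltr01.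
have C11 : C1 <= 1 by rewrite ge_min lexx.
have C1c : C1 <= c by rewrite ge_min lexx orbT.
have as2 : C1 <= a / s2.
  by rewrite (le_trans C11)// ler_pdivlMr// mul1r (le_trans (ltW s21)).
pose e1 := Num.min d (Num.min 1 (Num.min r0 (s2 * Num.min 1 (Num.min e0 r0)))).
have e10 : 0 < e1 by rewrite !lt_min d0 ltr01 r00 mulr_gt0// !lt_min ltr01 e00.
exists C1, (a / s2), e1; split=> // e; rewrite !lt_min.
move=> /andP[e_gt0 /and4P[ed e1' er es]]; split=> [w|u].
  have Ce0 : 0 < C1 * e by rewrite mulr_gt0.
  move=> /(BoxE _ sigma_gt0 Ce0) wB.
  have wc : `|dilation sigma e^-1 w| <= c.
    apply: row_norm_le => [|k]; first exact: ltW.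
    rewrite mxE normrM exprVn gtr0_norm ?invr_gt0 ?exprn_gt0//.
    rewrite ler_pdivrMl ?exprn_gt0// mulrC (le_trans (ltW (wB k)))//.
    rewrite exprMn ler_wpM2r ?exprn_ge0 ?(ltW e_gt0)//.
    by rewrite (le_trans (powle _ _ _)) ?C10.
  have [|x [xs Fx]] := surj e (dilation sigma e^-1 w) _ wc.
    by rewrite e_gt0.
  have x1 : `|x| < 1 by exact: le_lt_trans s21.
  exists (dilation sigma e x); split.
  - apply/(BoxE _ sigma_gt0 e_gt0) => k; rewrite mxE normrM.
    rewrite gtr0_norm ?exprn_gt0// gtr_pMr ?exprn_gt0//.
    exact: le_lt_trans (row_coord_le _ _) x1.
  - have e01 : 0 <= e <= 1 by rewrite !ltW.
    rewrite (le_lt_trans (dilation_norm sigma_gt0 x e01))//.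
    by rewrite (le_lt_trans _ er)// ler_piMr// ltW.
  - have := congr1 (dilation sigma e) Fx.
    by rewrite /scaled /= !dilationKV.
move=> /(BoxE _ sigma_gt0 e_gt0) uB.
(* A point of the box of size [e] is the dilation by [e'] of a point of norm at most [s2], because
   positive powers of [s2 < 1] are at most [s2]. *)
pose e' := e / s2.
have e'0 : 0 < e' by rewrite divr_gt0.
have : e' < Num.min 1 (Num.min e0 r0) by rewrite ltr_pdivrMr// mulrC.
rewrite !lt_min => /and3P[e'1 e'e0 e'r].
pose x := dilation sigma e'^-1 u.
have uE : u = dilation sigma e' x by rewrite dilationKV.
have xs : `|x| <= s2.
  apply: row_norm_le => [|k]; first exact: ltW.
  rewrite mxE normrM exprVn gtr0_norm ?invr_gt0 ?exprn_gt0//.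
  rewrite ler_pdivrMl ?exprn_gt0// (le_trans (ltW (uB k)))//.
  have -> : e = e' * s2 by rewrite divfK// gt_eqF.
  rewrite exprMn ler_wpM2l ?exprn_ge0 ?(ltW e'0)//.
  by rewrite (le_trans (powle _ _ _)) ?s20 ?(ltW s21).
have e'01 : 0 <= e' <= 1 by rewrite !ltW.
split.
  rewrite uE (le_lt_trans (dilation_norm sigma_gt0 x e'01))//.
  by rewrite (le_lt_trans _ e'r)// ler_piMr ?(ltW e'0)// (le_trans xs)// ltW.
have C2e : a / s2 * e = a * e' by rewrite /e' mulrAC mulrA.
apply/(BoxE _ sigma_gt0) => [|k]; first by rewrite C2e mulr_gt0.
rewrite C2e uE exprMn (le_lt_trans (psiC e' x k _ _)) ?e'0//.
  exact: le_lt_trans s2s'.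
rewrite ltr_pM2r ?exprn_gt0// (@lt_le_trans _ _ a)//.
  by rewrite (le_lt_trans (ler_norm C))// /a ltrDl.
by rewrite -(prednK (sigma_gt0 k)) exprS ler_peMr ?(ltW a0)// exprn_ege1.
Qed.

Theorem corollary3 (R : realType) (N m : nat) (M : cc_space R N m m) (p : M)
    (U : set M) (X : 'I_N -> M -> 'rV[R]_N) (theta : 'rV[R]_N -> M)
    (Phi : chart R N M)
    (Up : U p) (XU : subordinate_basis U X)
    (thetaP : canonical_coordinates U X p theta)
    (Phi_smooth : forall c, atlas c -> Ck_compatible m Phi c)
    (Phi_p : csrc Phi p) (Phi_0 : ctgt Phi 0) :
  let sigma := weight U X in
  let phi := cinv Phi in
  let phi_inv := cmap Phi in
  let F (e : R) :=
    dilation sigma e^-1 \o phi_inv \o theta \o dilation sigma e in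
  ((exists (L : 'rV[R]_N -> 'rV[R]_N) (V : set 'rV[R]_N),
      [/\ nbhs (0 : 'rV[R]_N) V,
          {uniform V, F e @[e --> 0^'+] --> L},
          forall e : R, 0 < e ->
            L \o dilation sigma e = dilation sigma e \o L &
          homeomorphism L]) /\
   (exists (lambda : 'rV[R]_N -> 'M[R]_N) (V : set 'rV[R]_N),
      [/\ nbhs (0 : 'rV[R]_N) V,
          {uniform V, (fun x => jacobian (F e) x) @[e --> 0^'+] --> lambda} &
          \det (lambda 0) != 0]))
  <->
  (exists C1 C2 e0 : R,
     [/\ 0 < C1, C1 <= C2, 0 < e0 &
         forall e : R, 0 < e < e0 ->
           phi @` Box sigma (C1 * e) `<=` theta @` Box sigma e /\
           theta @` Box sigma e `<=` phi @` Box sigma (C2 * e)]).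
Proof.
move=> sigma phi phi_inv F.
pose psi := phi_inv \o theta.
have [r0 [P [r00 psiP dpsi psi_det phiK]]] :=
  exp_coordinates_jet Up XU thetaP Phi_smooth Phi_p.
rewrite -/phi -/phi_inv -/psi in psiP dpsi psi_det phiK.
have sigma_gt0 j : (0 < sigma j)%N by case/andP: (weight_bounds U X j).
have sigma_lem j : (sigma j <= m)%N by case/andP: (weight_bounds U X j).
have sigma_le j : (sigma j <= m.-1.+1)%N by rewrite prednK// (cc_depth M).
have psi_scaled e x k : 0 < e ->
    psi (dilation sigma e x) 0 k = e ^+ sigma k * F e x 0 k.
  move=> e_gt0.
  have := dilationKV (sigma := sigma) (psi (dilation sigma e x)) e_gt0.
  by move=> /(congr1 (fun y : 'rV[R]_N => y 0 k)) <-; rewrite mxE.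
split=> [[[L [V [nV FL _ [cL _]]]] _]|[C1 [C2 [e0 [C10 C12 e00 box]]]]].
  have psi_bounded : dilation_bounded sigma psi.
    have /continuous_eps/(_ _ ltr01)[d1 d10 d1P] := cL 0.
    have [d2 /= d20 d2P] := (nbhs_ballP _ _).1 nV.
    have [e1 e10 e1P] := (uniform_eps _ _ _).1 FL 1 ltr01.
    (* One unit pays for the distance from [F e x] to [L x], the other for that from [L x] to
       [L 0]. *)
    exists (`|L 0| + 2), (Num.min d1 d2), e1; split=> //.
      by rewrite lt_min d10.
    move=> e x k ee; rewrite lt_min => /andP[xd1 xd2].
    have [e_gt0 _] := andP ee.
    rewrite psi_scaled// normrM ger0_norm ?exprn_ge0 ?(ltW e_gt0)// mulrC.
    rewrite ler_wpM2r ?exprn_ge0 ?(ltW e_gt0)//.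
    rewrite (le_trans (row_coord_le _ _))//.
    have h1 : `|F e x - L x| < 1.
      by apply: e1P => //; apply: d2P; rewrite -ball_normE /= sub0r normrN.
    have h2 : `|L x - L 0| < 1 by apply: d1P; rewrite subr0.
    have -> : F e x = (F e x - L x) + (L x - L 0) + L 0
      by rewrite -addrA !subrK.
    rewrite (le_trans (ler_normD _ _))//.
    by rewrite (le_trans (lerD (ler_normD _ _) (lexx _)))//; lra.
  have [C1 [C2 [e0 [C10 C12 e00 box]]]] :=
    dilation_bounded_box sigma_gt0 sigma_le psiP r00 dpsi psi_det psi_bounded.
  exists C1, C2, e0; split=> // e /box[lower upper].
  split=> [_ [w /lower[u [uB ur <-]] <-]|_ [u /upper[ur uB] <-]].
    by exists u => //; rewrite phiK.
  by exists (psi u) => //; rewrite phiK.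
have [rho /= rho0 rhoP] :=
  (nbhs_ballP _ _).1 (open_nbhs_nbhs (conj (@ctgt_open _ _ _ Phi) Phi_0)).
have C20 : 0 < C2 by exact: lt_le_trans C12.
have [C [s [e1 [s0 e10 psiC]]]] : dilation_bounded sigma psi.
  (* The constant dominates [C2 ^+ sigma k] for every weight up to [m]. The bound on [e] makes
     [C2 * e] less than 1 and [rho], so the box of that size lies in the target of the chart. *)
  exists ((C2 + 1) ^+ m), 1, (Num.min e0 (Num.min 1 rho / C2)); split=> //.
    by rewrite lt_min e00 divr_gt0// lt_min ltr01.
  move=> e x k; rewrite lt_min => /and3P[e_gt0 ee0].
  rewrite ltr_pdivlMr// lt_min => /andP[eC1 eCrho] x1.
  have [_ upper] := box e (introT andP (conj e_gt0 ee0)).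
  have xB : Box sigma e (dilation sigma e x).
    apply/(BoxE _ sigma_gt0 e_gt0) => j; rewrite mxE normrM.
    rewrite gtr0_norm ?exprn_gt0// gtr_pMr ?exprn_gt0//.
    exact: le_lt_trans (row_coord_le _ _) x1.
  have [w wB wE] := upper _ (imageP theta xB).
  have Ce0 : 0 < C2 * e by rewrite mulr_gt0.
  have {}wB := (BoxE w sigma_gt0 Ce0).1 wB.
  have wrho : `|w| < rho.
    apply: row_norm_lt => // j; rewrite (lt_trans (wB j))//.
    rewrite (le_lt_trans _ eCrho)// -(prednK (sigma_gt0 j)) exprS [e * _]mulrC.
    by rewrite ler_piMr ?(ltW Ce0)// exprn_ile1 ?(ltW Ce0)// mulrC ltW.
  (* The inclusion only provides equal images in the manifold; [w] is recovered because it lies in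
     the target of the chart, where [cinv] is injective. *)
  have -> : psi (dilation sigma e x) = w.
    have -> : psi (dilation sigma e x) = cmap Phi (cinv Phi w).
      exact: (congr1 phi_inv (esym wE)).
    rewrite cinvK//; apply: rhoP.
    by rewrite -ball_normE /= sub0r normrN.
  rewrite (le_trans (ltW (wB k)))// exprMn.
  rewrite ler_wpM2r ?exprn_ge0 ?(ltW e_gt0)//.
  rewrite (@le_trans _ _ ((C2 + 1) ^+ sigma k))//.
    by rewrite ler_pXn2r ?nnegrE ?addr_ge0 ?(ltW C20)// lerDl.
  by rewrite ler_weXn2l// lerDr ltW.
have s10 : 0 < Num.min 1 s by rewrite lt_min ltr01.
pose L := homogeneous_part (sigma := sigma) (P := P).
have nV : nbhs (0 : 'rV[R]_N) [set x | `|x| < Num.min 1 s].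
  apply/nbhs_ballP; exists (Num.min 1 s) => //= x.
  by rewrite -ball_normE /= sub0r normrN.
split.
  exists L, [set x | `|x| < Num.min 1 s]; split=> //.
  - apply/uniform_eps => eta eta0; have eta2 : 0 < eta / 2 by rewrite divr_gt0.
    have [d d0 dP] := scaled_cvg sigma_gt0 sigma_le psiP s0 e10 psiC eta2.
    by exists d => // e x ed xV; rewrite (le_lt_trans (dP e x ed xV))//; lra.
  - by move=> e _; apply/funext => x; exact: homogeneous_part_dilation.
  - exact: (homogeneous_part_homeomorphism sigma_gt0 sigma_le psiP s0 e10 psiC
      r00 dpsi psi_det).
exists (jacobian L), [set x | `|x| < Num.min 1 s]; split; first exact: nV.
  apply/uniform_eps => eta eta0; have eta2 : 0 < eta / 2 by rewrite divr_gt0.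
  have [d d0 dP] := jacobian_scaled_cvg sigma_gt0 sigma_le psiP e10 psiC
    r00 dpsi eta2.
  exists d => [|e x ed xV]; first exact: d0.
  suff key G : @scaled R N sigma psi e = G ->
      `|jacobian G x - jacobian L x| < eta by exact: key erefl.
  by move=> <-; apply: le_lt_trans (dP e x ed xV) _; lra.
have dE := det_homogeneous_part sigma_gt0 sigma_le psiP s0 e10 psiC r00 dpsi.
exact: (etrans (congr1 (fun z => z != 0) dE) psi_det).
Qed.
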